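(* Consider problem (P) of the context (with state constraints). Let $(x_*(\cdot),u_*(\cdot))\in\mathscr{A}_{adm}\cap\mathscr{A}_{Lip}$. Suppose there exist a function $p(\cdot):\mathbb{R}_+\to\mathbb{R}^n$, vectors $l_0,l_1\in\mathbb{R}^n$ and numbers $\beta_j\ge0$, $j=1,\dots,l$, such that: (a) $p(\cdot)$ satisfies piecewise the adjoint equation (see context), with associated $\{s_n\}$, $\{\beta_{jn}\}$, $\lambda_j(\cdot)$, that is, $$\dot p(t)=-H_x(t,x_*(t),u_*(t),p(t),1)+\sum_{j=1}^l\lambda_j(t)g_{jx}(t,x_*(t)),\quad t\in(s_n,s_{n+1}),$$ $$p(s_n^+)-p(s_n)=\sum_{j=1}^l\beta_{jn}g_{jx}(s_n,x_*(s_n)),\quad n=0,1,\dots;$$ moreover $$p(0)=l_0,\qquad\lim_{t\to\infty}p(t)=-l_1-\lim_{t\to\infty}\sum_{j=1}^l\beta_jg_{jx}(t,x_*(t)),$$ and for all admissible $x(\cdot)$ $$\langle l_0,x(0)-x_*(0)\rangle=0,\qquad\Big\langle l_1,\lim_{t\to\infty}\big(x(t)-x_*(t)\big)\Big\rangle=0;$$ (b) for almost all $t\in\mathbb{R}_+$, $H(t,x_*(t),u_*(t),p(t),1)=\max_{u\in U}H(t,x_*(t),u,p(t),1)$; (c) for $j=1,\dots,l$, $n=0,1,\dots$ and $t\in(s_n,s_{n+1})$: $$\beta_{jn}g_j(s_n,x_*(s_n))=0,\qquad\lim_{t\to\infty}\beta_jg_j(t,x_*(t))=0,\qquad\lambda_j(t)g_j(t,x_*(t))=0.$$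 Suppose furthermore that for some $\gamma>0$ and every $t$, on the ball $\{x\in\mathbb{R}^n\mid\|x-x_*(t)\|\le\gamma\}$ the function $x\mapsto\mathscr{H}(t,x,p(t))$ is concave and the functions $x\mapsto g_j(t,x)$, $j=1,\dots,l$, are convex. Then $(x_*(\cdot),u_*(\cdot))$ is a strong local minimizer in problem (P).
   Context: Notation: $\mathbb{R}_+=[0,\infty)$, $\overline{\mathbb{R}}_+=[0,\infty]$. $W^1_\infty(\mathbb{R}_+,\mathbb{R}^n)$ is the space of bounded, locally absolutely continuous functions with essentially bounded derivative; $L_\infty(\mathbb{R}_+,U)$ is the set of essentially bounded measurable functions with values in $U$. Data: $\omega\in L_1(\mathbb{R}_+,\mathbb{R})$, $\|\omega\|_{L_1}>0$; $f:\mathbb{R}\times\mathbb{R}^n\times\mathbb{R}^m\to\mathbb{R}$, $\varphi:\mathbb{R}\times\mathbb{R}^n\times\mathbb{R}^m\to\mathbb{R}^n$, $g_j:\mathbb{R}\times\mathbb{R}^n\to\mathbb{R}$ ($j=1,\dots,l$); $\emptyset\ne U\subseteq\mathbb{R}^m$; $x_0\in\mathbb{R}^n$. Problem (P): minimize $J(x,u)=\int_0^\infty\omega(t)f(t,x(t),u(t))\,dt$ subject to $\dot x(t)=\varphi(t,x(t),u(t))$ (Carathéodory sense on bounded intervals), $x(0)=x_0$, $\lim_{t\to\infty}x(t)=x_1$, $u(t)\in U$, $g_j(t,x(t))\le0$ for $t\in\mathbb{R}_+$, $j=1,\dots,l$. Here ''$\lim_{t\to\infty}x(t)=x_1$'' denotes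 a mixed endpoint condition: for some $k\in\{0,\dots,n\}$, $\lim_{t\to\infty}x^i(t)$ is free for $i=1,\dots,k$, and $\lim_{t\to\infty}x^i(t)=x_1^i$ with fixed numbers $x_1^i$ for $i=k+1,\dots,n$. $\mathscr{A}_{adm}$ (admissible processes): all $(x,u)\in W^1_\infty(\mathbb{R}_+,\mathbb{R}^n)\times L_\infty(\mathbb{R}_+,U)$ satisfying all constraints of (P) and making the Lebesgue integral $J$ finite; $x(\cdot)$ is admissible if $(x,u)\in\mathscr{A}_{adm}$ for some $u$. $\mathscr{A}_{Lip}$: all $(x,u)\in W^1_\infty\times L_\infty(\mathbb{R}_+,U)$ such that for every compact $U_1\subset\mathbb{R}^m$ there is $\gamma>0$ such that $f,\varphi,g_j$ are uniformly continuous in all variables and uniformly continuously differentiable in $x$ on $V_\gamma\times U_1$, where $V_\gamma=\{(t,y)\in\overline{\mathbb{R}}_+\times\mathbb{R}^n\mid\|y-x(t)\|\le\gamma\}$ (values at $t=\infty$ are limits as $t\to\infty$, whose existence is included). Strong local minimizer: admissible $(x_*,u_* )$ such that for some $\varepsilon>0$, $J(x,u)\ge J(x_*,u_* )$ for all $(x,u)\in\mathscr{A}_{adm}$ with $\|x-x_*\|_\infty\le\varepsilon$. Pontryagin function: $H(t,x,u,p,\lambda_0)=-\lambda_0\omega(t)f(t,x,u)+\langle p,\varphi(t,x,u)\rangle$. Hamiltonian: $\mathscr{H}(t,x,p)=\sup_{u\in U}H(t,x,u,p,1)$. Definition. $p(\cdot):\mathbb{R}_+\to\mathbb{R}^n$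 satisfies piecewise the adjoint equation iff there exist sequences $\{s_n\}$, $\{\beta_{jn}\}$ and functions $\lambda_j(\cdot)\in L_1(\mathbb{R}_+,\mathbb{R})$, $n=0,1,\dots$, $j=1,\dots,l$, such that: (1) $0=s_0<s_1<\dots$ and every finite interval $[0,T]$ contains only finitely many $s_n$; (2) the $\lambda_j$ are non-negative and continuous on each $(s_n,s_{n+1})$; (3) $\dot p(t)=-H_x(t,x_*(t),u_*(t),p(t),1)+\sum_{j}\lambda_j(t)g_{jx}(t,x_*(t))$ on $(s_n,s_{n+1})$ (in the Carathéodory sense: $p$ is absolutely continuous there and the equation holds almost everywhere); (4) $p(s_n^+)-p(s_n)=\sum_j\beta_{jn}g_{jx}(s_n,x_*(s_n))$, $\beta_{jn}\ge0$, $\sum_{n=0}^\infty\beta_{jn}<\infty$, where $p(s_n^+)$ is the right-sided limit; $p$ is continuous from the left. *)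

(* Defs.v *)
From HB Require Import structures.
From mathcomp Require Import all_boot all_order all_algebra.
From mathcomp Require Import all_classical all_reals all_analysis.

Set Implicit Arguments.
Unset Strict Implicit.
Unset Printing Implicit Defensive.

Import Order.TTheory GRing.Theory Num.Theory.
Import numFieldNormedType.Exports.

Local Open Scope classical_set_scope.
Local Open Scope ring_scope.

(* Lebesgue (not merely Borel) measurability and integration on the real line:
   [leb R] carries the complete sigma-algebra of Lebesgue measurable sets.
   Functions on R_+ are total functions on R of which only the values on
   [Rplus] are ever used.  R^n is ['rV[R]_n] with the library's max norm; norms
   only occur below bounded by a radius that is existentially quantified, so
   the choice of the norm is immaterial. *)
Notation leb R := (@completed_lebesgue_measure R).
Notation lebR R := (caratheodory_type ((@wlength R idfun)^*)%mu).

Definition Rplus (R : realType) : set (lebR R) := [set t : R | 0 <= t].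
Arguments Rplus R : clear implicits.

Definition dot (R : realType) (n : nat) (a b : 'rV[R]_n) : R :=
  \sum_(i < n) a 0 i * b 0 i.

Definition grad (R : realType) (n : nat) (h : 'rV[R]_n -> R) (y : 'rV[R]_n) :
    'rV[R]_n :=
  \row_(i < n) 'D_(delta_mx 0 i) h y.

Definition abs_continuous_on (R : realType) (V : normedModType R) (D : set R)
    (h : R -> V) : Prop :=
  forall e : R, 0 < e -> exists2 d : R, 0 < d &
    forall (q : nat) (a b : 'I_q -> R),
      (forall i, [/\ D (a i), D (b i) & a i <= b i]) ->
      trivIset [set: 'I_q] (fun i => `]a i, b i[%classic) ->
      \sum_(i < q) (b i - a i) < d ->
      \sum_(i < q) `|h (b i) - h (a i)| < e.

Definition W1oo (R : realType) (n : nat) (x : R -> 'rV[R]_n) : Prop :=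
  [/\ exists M : R, forall t, 0 <= t -> `|x t| <= M,
      forall T : R, abs_continuous_on `[0, T] x &
      exists M : R, {ae leb R, forall t : R, 0 <= t ->
        derivable x t 1 /\ `|'D_1 x t| <= M}].

Definition Loo (R : realType) (m : nat) (U : set 'rV[R]_m)
    (u : R -> 'rV[R]_m) : Prop :=
  [/\ forall i : 'I_m, measurable_fun (Rplus R) (fun t => u t 0 i),
      exists M : R, {ae leb R, forall t : R, 0 <= t -> `|u t| <= M} &
      forall t, 0 <= t -> U (u t)].

Definition L1 (R : realType) (h : R -> R) : Prop :=
  (leb R).-integrable (Rplus R) (fun t => (h t)%:E).

(* The endpoint condition is mixed: the components of index [i < ocp_k] have a
   free limit and those of index [ocp_k <= i] must tend to [ocp_x1 0 i]; the
   components of [ocp_x1] of index [< ocp_k] are irrelevant. *)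
Record ocp (R : realType) (n m l : nat) := Ocp {
  ocp_omega : R -> R ;
  ocp_f : R -> 'rV[R]_n -> 'rV[R]_m -> R ;
  ocp_phi : R -> 'rV[R]_n -> 'rV[R]_m -> 'rV[R]_n ;
  ocp_g : 'I_l -> R -> 'rV[R]_n -> R ;
  ocp_U : set 'rV[R]_m ;
  ocp_x0 : 'rV[R]_n ;
  ocp_k : nat ;
  ocp_x1 : 'rV[R]_n
}.

Definition ocp_wf (R : realType) (n m l : nat) (P : ocp R n m l) : Prop :=
  [/\ L1 (ocp_omega P),
      (0 < \int[leb R]_(t in Rplus R) `|ocp_omega P t|%:E)%E,
      ocp_U P !=set0 &
      (ocp_k P <= n)%N].

Definition cost_density (R : realType) (n m l : nat) (P : ocp R n m l)
    (x : R -> 'rV[R]_n) (u : R -> 'rV[R]_m) (t : R) : R :=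
  ocp_omega P t * ocp_f P t (x t) (u t).

Definition J (R : realType) (n m l : nat) (P : ocp R n m l)
    (x : R -> 'rV[R]_n) (u : R -> 'rV[R]_m) : \bar R :=
  (\int[leb R]_(t in Rplus R) (cost_density P x u t)%:E)%E.

(* "Free limit" means that the limit exists and is otherwise unrestricted. *)
Definition endpoint (R : realType) (n m l : nat) (P : ocp R n m l)
    (x : R -> 'rV[R]_n) : Prop :=
  cvg (x t @[t --> +oo]) /\
  forall i : 'I_n, (ocp_k P <= i)%N ->
    x t 0 i @[t --> +oo] --> ocp_x1 P 0 i.

Record admissible (R : realType) (n m l : nat) (P : ocp R n m l)
    (x : R -> 'rV[R]_n) (u : R -> 'rV[R]_m) : Prop := Admissible {
  adm_x : W1oo x ;
  adm_u : Loo (ocp_U P) u ;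
  adm_dynamics : {ae leb R, forall t : R, 0 <= t ->
    is_derive t 1 x (ocp_phi P t (x t) (u t))} ;
  adm_x0 : x 0 = ocp_x0 P ;
  adm_x1 : endpoint P x ;
  adm_g : forall (j : 'I_l) (t : R), 0 <= t -> ocp_g P j t (x t) <= 0 ;
  adm_J : L1 (cost_density P x u)
}.

(* Extension to t = +oo by the limit (the value at -oo is never used). *)
Definition ext_oo (R : realType) (W : normedModType R) (h : R -> W)
    (t : \bar R) : W :=
  if t is r%:E then h r else lim (h r @[r --> +oo]).

Definition tube (R : realType) (n : nat) (x : R -> 'rV[R]_n) (gamma : R) :
    set (\bar R * 'rV[R]_n) :=
  [set ty | (0 <= ty.1)%E /\ `|ty.2 - ext_oo x ty.1| <= gamma].

(* Balls in [\bar R] are those of the library's metric, which induces the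
   topology of the compactified line. *)
Definition unif_continuous_on (R : realType) (T W : pseudoMetricType R)
    (A : set T) (F : T -> W) : Prop :=
  forall e : R, 0 < e -> exists2 d : R, 0 < d &
    forall a b : T, A a -> A b -> ball a d b -> ball (F a) e (F b).

Definition unif_continuous_tube (R : realType) (n m : nat)
    (W : normedModType R) (x : R -> 'rV[R]_n) (gamma : R)
    (U1 : set 'rV[R]_m) (h : R -> 'rV[R]_n -> 'rV[R]_m -> W) : Prop :=
  (forall y v, tube x gamma (+oo%E, y) -> U1 v ->
     cvg (h t y v @[t --> +oo])) /\
  unif_continuous_on (tube x gamma `*` U1)
    (fun q : \bar R * 'rV[R]_n * 'rV[R]_m =>
       ext_oo (fun t => h t q.1.2 q.2) q.1.1).

Definition unif_C1_tube (R : realType) (n m : nat)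
    (W : normedModType R) (x : R -> 'rV[R]_n) (gamma : R)
    (U1 : set 'rV[R]_m) (h : R -> 'rV[R]_n -> 'rV[R]_m -> W) : Prop :=
  [/\ unif_continuous_tube x gamma U1 h,
      forall t y v, tube x gamma (t%:E, y) -> U1 v ->
        differentiable (fun z => h t z v) y &
      forall i : 'I_n, unif_continuous_tube x gamma U1
        (fun t y v => 'D_(delta_mx 0 i) (fun z => h t z v) y)].

Record A_Lip (R : realType) (n m l : nat) (P : ocp R n m l)
    (x : R -> 'rV[R]_n) (u : R -> 'rV[R]_m) : Prop := ALip {
  Lip_x : W1oo x ;
  Lip_u : Loo (ocp_U P) u ;
  Lip_xoo : cvg (x t @[t --> +oo]) ;
  Lip_C1 : forall U1 : set 'rV[R]_m, compact U1 ->
    exists2 gamma : R, 0 < gamma &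
      [/\ unif_C1_tube x gamma U1 (ocp_f P),
          unif_C1_tube x gamma U1 (ocp_phi P) &
          forall j : 'I_l, unif_C1_tube x gamma U1
            (fun t y _ => ocp_g P j t y)]
}.

Definition strong_local_minimizer (R : realType) (n m l : nat)
    (P : ocp R n m l) (xs : R -> 'rV[R]_n) (us : R -> 'rV[R]_m) : Prop :=
  admissible P xs us /\
  exists2 e : R, 0 < e & forall x u, admissible P x u ->
    (forall t, 0 <= t -> `|x t - xs t| <= e) ->
    (J P xs us <= J P x u)%E.

Definition pontryagin (R : realType) (n m l : nat) (P : ocp R n m l)
    (t : R) (y : 'rV[R]_n) (v : 'rV[R]_m) (q : 'rV[R]_n) (lam0 : R) : R :=
  - lam0 * ocp_omega P t * ocp_f P t y v + dot q (ocp_phi P t y v).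

(* The supremum may be +oo. *)
Definition hamiltonian (R : realType) (n m l : nat) (P : ocp R n m l)
    (t : R) (y : 'rV[R]_n) (q : 'rV[R]_n) : \bar R :=
  ereal_sup [set (pontryagin P t y v q 1)%:E | v in ocp_U P].

Definition concave_on (R : realType) (n : nat) (D : set 'rV[R]_n)
    (h : 'rV[R]_n -> \bar R) : Prop :=
  forall (y z : 'rV[R]_n) (a : R), D y -> D z -> 0 <= a <= 1 ->
    (a%:E * h y + (1 - a)%:E * h z <= h (a *: y + (1 - a) *: z)%R)%E.

Record piecewise_adjoint (R : realType) (n m l : nat) (P : ocp R n m l)
    (xs : R -> 'rV[R]_n) (us : R -> 'rV[R]_m) (p : R -> 'rV[R]_n)
    (s : nat -> R) (bet : 'I_l -> nat -> R) (lam : 'I_l -> R -> R) : Prop :=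
  PiecewiseAdjoint {
  adj_s0 : s 0 = 0 ;
  adj_s_incr : forall k, s k < s k.+1 ;
  adj_s_finite : forall T : R, finite_set [set k | s k <= T] ;
  adj_lam_L1 : forall j, L1 (lam j) ;
  adj_lam_ge0 : forall j k t, s k < t < s k.+1 -> 0 <= lam j t ;
  adj_lam_cont : forall j k t, s k < t < s k.+1 ->
    {for t, continuous (lam j)} ;
  adj_p_ac : forall k, abs_continuous_on `]s k, s k.+1[ p ;
  adj_p_eq : forall k, {ae leb R, forall t : R, s k < t < s k.+1 ->
    is_derive t 1 p
      (- grad (fun y => pontryagin P t y (us t) (p t) 1) (xs t)
       + \sum_(j < l) lam j t *: grad (ocp_g P j t) (xs t))} ;
  adj_p_jump : forall k, exists2 pk : 'rV[R]_n,
    p t @[t --> (s k)^'+] --> pk &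
    pk - p (s k) = \sum_(j < l) bet j k *: grad (ocp_g P j (s k)) (xs (s k)) ;
  adj_bet_ge0 : forall j k, 0 <= bet j k ;
  adj_bet_sum : forall j, (\sum_(0 <= k <oo) (bet j k)%:E < +oo)%E ;
  adj_p_left : forall t, 0 < t -> p r @[r --> t^'-] --> p t
}.

(* Main.v *)
(** Let (x, u) be admissible with x in the gamma-tube around xs, and put
    F = <p, x - xs> and h = omega f(., x, u) - omega f(., xs, us).  Concavity of
    the Hamiltonian and differentiability of H(t, ., us, p) at xs make H_x a
    supergradient (Arrow's argument), and convexity together with complementary
    slackness makes every multiplier term <lambda_j g_jx, x - xs> nonpositive;
    with the adjoint equation this gives F' <= h almost everywhere between two
    jumps.  For the same reason F cannot increase at a jump of p.  Since F is
    absolutely continuous between jumps and F(0) = 0, F(s_k) is at most the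
    integral of h over [0, s_k]; as k -> oo the transversality condition bounds
    the limit of F from below by 0.

    The integration of F' <= h is done by a gauge argument: h is only Lebesgue
    measurable and p is only absolutely continuous, so the argument combines
    Cousin's lemma with a Vitali-Caratheodory majorisation of h by means of open
    supersets of its superlevel sets. *)

Require Import Defs.
From HB Require Import structures.
From mathcomp Require Import all_boot all_order all_algebra.
From mathcomp Require Import all_classical all_reals all_analysis.
From mathcomp Require Import measurable_realfun ring lra.

Set Implicit Arguments.
Unset Strict Implicit.
Unset Printing Implicit Defensive.

Import Order.TTheory GRing.Theory Num.Theory.
Import numFieldNormedType.Exports.

Local Open Scope classical_set_scope.
Local Open Scope ring_scope.

(** * A one-sided fundamental theorem for absolutely continuous functions *)

Lemma measurable_lebR (R : realType) (A : set R) :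
  measurable (A : set (measurableTypeR R)) -> measurable (A : set (lebR R)).
Proof. by move=> mA; exact: sub_caratheodory. Qed.

Lemma measurable_itv_lebR (R : realType) (i : interval R) :
  measurable ([set` i] : set (lebR R)).
Proof. by apply: measurable_lebR; exact: measurable_itv. Qed.

Lemma leb_itv_oc (R : realType) (u v : R) : u <= v ->
  leb R `]u, v]%classic = (v - u)%:E.
Proof.
(* Both measures are the same set function on different sigma-algebras, so they agree here by
   conversion. *)
move=> uv; rewrite -[LHS]/(@lebesgue_measure R `]u, v]%classic).
rewrite lebesgue_measure_itv /= lte_fin -EFinB.
by case: ltgtP uv => // -> _; rewrite subrr.
Qed.

Lemma integral_abs_continuous d (T : measurableType d) (R : realType)
    (mu : {measure set T -> \bar R}) (D : set T) (k : T -> R) (e : R) :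
  measurable D -> mu.-integrable D (EFin \o k) ->
  (forall x, D x -> 0 <= k x) -> 0 < e ->
  exists2 del : R, 0 < del & forall A, measurable A -> A `<=` D ->
    (mu A < del%:E)%E -> (\int[mu]_(x in A) (k x)%:E <= e%:E)%E.
Proof.
move=> mD ik k0 e0.
have mk : measurable_fun D k by apply/measurable_EFinP; exact: measurable_int ik.
(* k = min(k, N) + (k - N)^+, and the second term has small integral over D. *)
pose g n x : R := Num.max 0 (k x - n%:R).
have mg n : measurable_fun D (g n).
  apply: measurable_maxr; first exact: measurable_cst.
  by apply: measurable_funB => //; exact: measurable_cst.
have g0 n x : 0 <= g n x by rewrite /g le_max lexx.
have := @dominated_convergence _ _ _ mu D mD (fun n x => (g n x)%:E) (cst 0%E)
  (EFin \o k).
case.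
- by move=> n; apply/measurable_EFinP.
- exact: measurable_cst.
- apply: aeW => x Dx; apply/fine_cvgP; split; first by near=> n.
  apply: cvg_near_cst; near=> n => /=.
  rewrite /g; apply/max_idPl; rewrite subr_le0.
  near: n; exact: nbhs_infty_ger.
- exact: ik.
- apply: aeW => x n Dx; rewrite /= ger0_norm // lee_fin /g ge_max k0 //=.
  by rewrite gerBl.
move=> _ _ /=.
have -> : (\int[mu]_(x in D) cst 0 x = 0)%E by rewrite integral0.
move=> /fine_cvgP[/= fin] /cvgr_lt.
move/(_ (e / 2)); rewrite divr_gt0// => /(_ isT) gtr.
near \oo => N.
have intN : (\int[mu]_(x in D) (g N x)%:E <= (e / 2)%:E)%E.
  rewrite -[leLHS]fineK; last by near: N; exact: fin.
  by rewrite lee_fin ltW//; near: N; exact: gtr.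
(* On [A] one has [k <= g N + N.+1], and each summand contributes at most [e / 2]; the successor
   keeps the divisor positive. *)
exists (e / 2 / N.+1%:R); first by rewrite !divr_gt0.
move=> A mA AD muA.
have mgA : measurable_fun A (EFin \o g N).
  by apply/measurable_EFinP; apply: measurable_funS (mg N).
apply: (@le_trans _ _ (\int[mu]_(x in A) ((g N x)%:E + (N.+1%:R)%:E))%E).
  apply: ge0_le_integral => //.
  - by move=> x /AD/k0; rewrite lee_fin.
  - by apply/measurable_EFinP; apply: measurable_funS mk.
  - by apply: emeasurable_funD => //; exact: measurable_cst.
  - move=> x Ax; rewrite -EFinD lee_fin.
    have : k x - N%:R <= g N x by rewrite /g le_max lexx orbT.
    have : N%:R <= N.+1%:R :> R by rewrite ler_nat.
    lra.
rewrite ge0_integralD //; last by move=> x _; rewrite lee_fin.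
rewrite [e in leRHS]splitr EFinD; apply: leeD.
  apply: le_trans intN; apply: ge0_subset_integral => //.
    exact/measurable_EFinP.
  by move=> x _; rewrite lee_fin.
rewrite [leLHS](integral_cst mu mA N.+1%:R%:E).
apply: (@le_trans _ _ (N.+1%:R%:E * (e / 2 / N.+1%:R)%:E)%E).
  by rewrite lee_pmul2l // ?ltW.
by rewrite -EFinM lee_fin mulrC divfK.
Unshelve. all: by end_near. Qed.

(* Cousin's lemma, phrased for additive interval properties instead of tagged
   partitions. *)
Lemma cousin_ind (R : realType) (a b : R) (Q : R -> R -> Prop) : a <= b ->
  (forall u v w, a <= u -> u <= v -> v <= w -> w <= b ->
    Q u v -> Q v w -> Q u w) ->
  (forall t, a <= t <= b -> exists2 r, 0 < r & forall u v,
    a <= u -> u <= t -> t <= v -> v <= b -> t - r < u -> v < t + r -> Q u v) ->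
  Q a b.
Proof.
move=> ab trans loc.
pose S := [set v | a <= v <= b /\ Q a v].
have Sa : S a.
  split; first by rewrite lexx.
  have [|r r0 H] := loc a; first by rewrite lexx.
  by apply: H; rewrite ?lexx //; lra.
have ubS : ubound S b by move=> v [/andP[]].
have supS : has_sup S by split; [exists a | exists b].
set s := sup S.
have sa : a <= s by apply: ub_le_sup Sa; exists b.
have sb : s <= b by apply: ge_sup => //; exists a.
have [|r r0 H] := loc s; first by rewrite sa.
have [v Sv vs] := @sup_adherent _ S r r0 supS.
have vles : v <= s by apply: ub_le_sup Sv; exists b.
move: Sv => [/andP[av vb] Qav].
(* Gluing []v, w]] around [s] puts [w] in [S], hence [w <= s]; since [s + r / 2] exceeds [s], the
   minimum must be [b]. *)
pose w := Num.min b (s + r / 2).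
have sw : s <= w by rewrite /w le_min sb; lra.
have wb : w <= b by rewrite /w ge_min lexx.
have wr : w <= s + r / 2 by rewrite /w ge_min lexx orbT.
have Qvw : Q v w by apply: H => //; rewrite -/s in vs *; lra.
have Qaw : Q a w by apply: (trans a v w) => //; lra.
have : w <= s.
  apply: ub_le_sup; first by exists b.
  by split => //; rewrite wb (le_trans av)// (le_trans vles).
rewrite /w ge_min => /orP[bs|]; last by move=> ?; lra.
suff <- : w = b by [].
by apply/eqP; rewrite eq_le wb (le_trans bs).
Qed.

(** Straddle lemma: [F u] and [F v] are each compared with [F t], and since [t] lies between [u] and
    [v] the errors [e * (t - u)] and [e * (v - t)] add up to [e * (v - u)]. *)
Lemma is_derive_increment_le (R : realType) (F : R -> R) (t dF e : R) :
  is_derive t 1 F dF -> 0 < e ->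
  exists2 r : R, 0 < r & forall u v, u <= t -> t <= v -> t - r < u -> v < t + r ->
    F v - F u <= (dF + e) * (v - u).
Proof.
move=> [dvF <-] e0.
have /cvgrPdist_le /(_ _ e0) := dvF.
rewrite -/('D_1 F t).
move=> [r /= r0 H].
have key s : `|s - t| < r -> `|F s - F t - 'D_1 F t * (s - t)| <= e * `|s - t|.
  move=> str; have [->|st] := eqVneq s t; first by rewrite !subrr mulr0 subrr normr0 mulr0.
  have st0 : s - t != 0 by rewrite subr_eq0.
  have := H (s - t); rewrite /= sub0r normrN => /(_ str st0).
  rewrite -[(s - t) *: 1]/((s - t) * 1) mulr1 subrK.
  rewrite -[_ *: _]/((s - t)^-1 * (F s - F t)) => le1.
  have : `|s - t| * `|'D_1 F t - (s - t)^-1 * (F s - F t)| <= `|s - t| * e.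
    by rewrite ler_pM2l // normr_gt0.
  rewrite -normrM mulrBr mulrA divff // mul1r [e * _]mulrC.
  by rewrite distrC [_ * 'D_1 F t]mulrC.
exists r => // u v ut tv ru rv.
have := key u; rewrite ler0_norm ?subr_le0 // opprB => /(_ ltac:(lra)).
rewrite ler_norml => /andP[Hu _].
have := key v; rewrite ger0_norm ?subr_ge0 // => /(_ ltac:(lra)).
rewrite ler_norml => /andP[_ Hv].
lra.
Qed.

(** An ordered list, unlike the indexed disjoint families in [abs_continuous_on], can be
    concatenated when Cousin's lemma glues two adjacent intervals. *)
Definition intervals_in (R : realType) (u v : R) (s : seq (R * R)) : bool :=
  all (fun I => [&& u <= I.1, I.1 <= I.2 & I.2 <= v]) s &&
  pairwise (fun I J => I.2 <= J.1) s.

Lemma intervals_in_cat (R : realType) (u v w : R) (s1 s2 : seq (R * R)) :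
  u <= v -> v <= w -> intervals_in u v s1 -> intervals_in v w s2 ->
  intervals_in u w (s1 ++ s2).
Proof.
move=> uv vw /andP[/allP a1 p1] /andP[/allP a2 p2].
rewrite /intervals_in all_cat pairwise_cat p1 p2 !andbT.
apply/andP; split; first (apply/andP; split; apply/allP).
- by move=> I /a1 /and3P[-> -> /le_trans]; exact.
- by move=> I /a2 /and3P[/(le_trans uv) -> -> ->].
- apply/allrelP => I J /a1 /and3P[_ _ Iv] /a2 /and3P[vJ _ _].
  exact: le_trans vJ.
Qed.

Lemma abs_continuous_intervals (R : realType) (V : normedModType R)
    (D : set R) (F : R -> V) (e : R) :
  abs_continuous_on D F -> 0 < e ->
  exists2 d : R, 0 < d & forall u v s, `[u, v] `<=` D -> intervals_in u v s ->
    \sum_(I <- s) (I.2 - I.1) < d -> \sum_(I <- s) `|F I.2 - F I.1| < e.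
Proof.
move=> acF e0; have [d d0 H] := acF e e0; exists d => // u v s uvD.
move=> /andP[/allP alls /(pairwiseP (0, 0)) pws] sd.
pose x0 : R * R := (0, 0).
have mems (i : 'I_(size s)) : nth x0 s i \in s by exact: mem_nth.
rewrite (big_nth x0) big_mkord; apply: H; last first.
- by rewrite (big_nth x0) big_mkord in sd.
- apply/trivIsetP => i j _ _.
  wlog ij : i j / (i < j)%N => [wl|].
    move=> ij; have [/wl|ji|/val_inj ij'] := ltngtP i j; first exact.
      by rewrite setIC; apply: wl => //; rewrite eq_sym.
    by rewrite ij' eqxx in ij.
  move=> _; rewrite -subset0 => x [] /=; rewrite !in_itv /=.
  move=> /andP[_ xi] /andP[jx _].
  have := pws i j (ltn_ord i) (ltn_ord j) ij.
  by move/(lt_le_trans xi)/(lt_trans)/(_ jx); rewrite ltxx.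
- move=> i; have /and3P[u1 h12 h2v] := alls _ (mems i).
  split => //; apply: uvD; rewrite /= in_itv /=; first by rewrite u1 (le_trans h12).
  by rewrite h2v andbT (le_trans u1).
Qed.

(** Intervals are half-open so that adjacent ones are disjoint; this makes the error weights of the
    gauge argument exactly additive. *)
Lemma ge0_integral_oc_split (R : realType) (E S : set (lebR R)) (k : R -> R) (u v w : R) :
  measurable E -> measurable S -> `]u, w] `<=` S -> measurable_fun S k ->
  (forall x, S x -> 0 <= k x) -> u <= v -> v <= w ->
  (\int[leb R]_(x in (`]u, w]%classic : set R) `&` E) (k x)%:E =
   \int[leb R]_(x in (`]u, v]%classic : set R) `&` E) (k x)%:E +
   \int[leb R]_(x in (`]v, w]%classic : set R) `&` E) (k x)%:E)%E.
Proof.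
move=> mE mS uwS mk k0 uv vw.
have mi := @measurable_itv_lebR R.
have -> : `]u, w]%classic `&` E =
    (`]u, v]%classic `&` E) `|` (`]v, w]%classic `&` E).
  rewrite -setIUl -itv_bndbnd_setU //.
have sub : (`]u, v]%classic `&` E) `|` (`]v, w]%classic `&` E) `<=` S.
  move=> x H; apply: uwS; case: H => -[] /=; rewrite !in_itv /= => /andP[h1 h2] _.
    by rewrite h1 (le_trans h2).
  by rewrite h2 (le_lt_trans uv).
rewrite ge0_integral_setU //.
- exact: measurableI.
- exact: measurableI.
- apply/measurable_EFinP; apply: measurable_funS mk => //.
- by move=> x /sub/k0; rewrite lee_fin.
- apply/eqP; rewrite -subset0 => x [[]] /=; rewrite !in_itv /=.
  by move=> /andP[_ xv] _ [/andP[vx _] _]; rewrite ltNge xv in vx.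
Qed.

(** Open supersets approximate the outer measure; finiteness of [leb R A] allows it to be
    subtracted, which bounds the measure of the difference. *)
Lemma lebR_regularity_outer (R : realType) (A : set (lebR R)) (e : R) :
  measurable A -> (leb R A < +oo)%E -> 0 < e ->
  exists G : set R, [/\ open G, A `<=` G,
    measurable (G : set (lebR R)) & (leb R (G `\` A) < e%:E)%E].
Proof.
move=> mA Aoo e0.
have e20 : 0 < e / 2 by rewrite divr_gt0.
have [G [oG AG Ge]] := @outer_measure_open_le R A _ e20.
have mG : measurable (G : set (lebR R)) by apply: measurable_lebR; exact: open_measurable.
have {}Ge : (leb R G <= leb R A + (e / 2)%:E)%E by exact: Ge.
have Afin : leb R A \is a fin_num by rewrite ge0_fin_numE.
have Goo : (leb R G < +oo)%E.
  by apply: le_lt_trans Ge _; rewrite ltey_eq fin_numD Afin.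
exists G; split => //.
rewrite measureD // setIidr // lteBlDr //.
apply: le_lt_trans Ge _; rewrite addeC lteD2rE // lte_fin; lra.
Qed.

Lemma oc_subset_ball (R : realType) (u v t r : R) :
  t - r < u -> v < t + r -> `]u, v] `<=` ball t r.
Proof.
move=> tu vt x; rewrite /= in_itv /= => /andP[ux xv].
by rewrite /ball /= ltr_norml; apply/andP; split; lra.
Qed.

(** * The integral inequality by a gauge argument *)

Section abs_continuous_le_integral.
Variables (R : realType) (F h : R -> R) (a b : R).
Hypothesis ab : a <= b.
Hypothesis acF : abs_continuous_on `[a, b] F.
Hypothesis ih : (leb R).-integrable (`[a, b]%classic : set R) (EFin \o h).
Hypothesis Fh : {ae leb R, forall t : R, a <= t <= b ->
  exists2 dF : R, is_derive t 1 F dF & dF <= h t}.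

Let I : set (lebR R) := `[a, b]%classic.

Let mitv := @measurable_itv_lebR R.

Let mI : measurable I. Proof. exact: mitv. Qed.

Let mh : measurable_fun I h.
Proof. by apply/measurable_EFinP; exact: measurable_int ih. Qed.

Let leb_subI (A : set (lebR R)) : measurable A -> A `<=` I -> (leb R A < +oo)%E.
Proof.
move=> mA AI; apply: (@le_lt_trans _ _ (leb R I)); first by rewrite le_measure ?inE.
rewrite -[ltLHS]/(@lebesgue_measure R `[a, b]%classic) lebesgue_measure_itv.
by case: ifP => _ //; rewrite -EFinB ltry.
Qed.

(** An enumeration of the rationals; indices that decode to nothing give 0, and repetitions are
    harmless. *)
Let c (i : nat) : R := ratr (odflt 0%Q (unpickle i)).

Let c_dense (x y : R) : x < y -> exists i, x < c i < y.
Proof.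
move=> /rat_in_itvoo [q]; rewrite in_itv /= => xqy.
by exists (pickle q); rewrite /c pickleK.
Qed.

Let A (i : nat) : set (lebR R) := I `&` [set t | c i < h t].

Let mA i : measurable (A i).
Proof.
rewrite (_ : A i = I `&` h @^-1` `]c i, +oo[%classic).
  by apply: mh => //; exact: measurable_itv.
by congr (_ `&` _); apply/seteqP; split => t /=; rewrite in_itv /= andbT.
Qed.

(** Since [c i - h <= k i] everywhere, [k i] controls the cost of replacing [h] by the constant
    [c i] at points where [h] is smaller than [c i]. *)
Let k i t : R := `|c i| + `|h t|.

Let mnh : measurable_fun I (fun t => `|h t|).
Proof. by apply: measurableT_comp mh. Qed.

Let mk i : measurable_fun I (k i).
Proof. apply: measurable_funD; [exact: measurable_cst|exact: mnh]. Qed.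

Let ik i : (leb R).-integrable I (EFin \o k i).
Proof.
rewrite (_ : EFin \o k i = cst (`|c i|%:E) \+ (EFin \o (fun t => `|h t|))) //.
apply: integrableD => //; last exact: integrable_norm.
apply: (measurable_bounded_integrable mI (leb_subI mI _)) => //.
by exists `|c i|; split; [exact: num_real|move=> M cM t _ /=; rewrite normr_id ltW].
Qed.

(** Outer regularity makes [G i] exceed [A i] by a set so small that absolute continuity of the
    integral of [k i] applies; the bounds sum to [e] over [i]. *)
Let superlevel_open_cover (e : R) : 0 < e -> exists G : nat -> set R, forall i,
  [/\ open (G i), measurable (G i : set (lebR R)), A i `<=` G i &
  (\int[leb R]_(t in I `&` (G i `\` A i)) (k i t)%:E <= (e / (2 ^ i.+1)%:R)%:E)%E].
Proof.
move=> e0.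
suff H i : exists G : set R, [/\ open G, measurable (G : set (lebR R)), A i `<=` G &
    (\int[leb R]_(t in I `&` (G `\` A i)) (k i t)%:E <= (e / (2 ^ i.+1)%:R)%:E)%E].
  by exists (fun i => sval (cid (H i))) => i; exact: (svalP (cid (H i))).
have ei0 : 0 < e / (2 ^ i.+1)%:R by rewrite divr_gt0 // ltr0n expn_gt0.
have [|del del0 H] := integral_abs_continuous mI (ik i) _ ei0.
  by move=> t _; rewrite addr_ge0.
have [G [oG AG mG Gdel]] := @lebR_regularity_outer R (A i) del (mA i)
  (leb_subI (mA i) (@subIsetl _ _ _)) del0.
exists G; split => //.
have mD : measurable (I `&` (G `\` A i)) by apply: measurableI => //; exact: measurableD.
apply: H => //; apply: le_lt_trans Gdel.
by rewrite le_measure ?inE //; exact: measurableD.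
Qed.

(** The interval is cut by the set [E] of its points outside [A i]. Off [E] one has [c i < h], and
    on [E] one has [c i <= k i + h]. *)
Let superlevel_const_le (u v : R) (i : nat) (G : set (lebR R)) :
  a <= u -> u <= v -> v <= b ->
  measurable G -> `]u, v] `<=` G ->
  ((c i * (v - u) - \int[leb R]_(t in (`]u, v]%classic : set R)) h t)%:E <=
    \int[leb R]_(t in (`]u, v]%classic : set R) `&` (I `&` (G `\` A i))) (k i t)%:E)%E.
Proof.
move=> au uv vb mG uvG.
set J : set (lebR R) := `]u, v]%classic.
have mJ : measurable J by exact: mitv.
have JI : J `<=` I.
  move=> x; rewrite /J /I /= !in_itv /= => /andP[ux xv].
  by rewrite (le_trans xv) // andbT (le_trans au) // ltW.
set E : set (lebR R) := J `&` (I `&` (G `\` A i)).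
have mE : measurable E by do 2 apply: measurableI => //; exact: measurableD.
have EJ : E `<=` J by exact: subIsetl.
have JE : J = (J `\` E) `|` E by rewrite setUC setDUK.
have ihJ : (leb R).-integrable J (EFin \o h) by exact: integrableS ih.
have icJ : (leb R).-integrable J (EFin \o cst (c i)).
  apply: (measurable_bounded_integrable mJ (leb_subI mJ JI)) => //.
  by exists `|c i|; split; [exact: num_real|move=> M cM t' _ /=; rewrite ltW].
have mJE : measurable (J `\` E) by exact: measurableD.
have ikE : (leb R).-integrable E (EFin \o k i).
  by apply: integrableS (ik i) => //; exact: subset_trans JI.
have dis : [disjoint J `\` E & E] by apply/eqP; rewrite setDKI.
have -> : (\int[leb R]_(t in E) (k i t)%:E = (\int[leb R]_(t in E) k i t)%:E)%E.
  by rewrite fineK //; exact: integrable_fin_num.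
rewrite lee_fin lerBlDr.
have -> : c i * (v - u) = \int[leb R]_(_ in J) (c i).
  rewrite Rintegral_cst //; congr (_ * _).
  by have /(congr1 fine) := leb_itv_oc uv.
have sub1 : J `\` E `<=` J by exact: subDsetl.
have split_int (f : R -> R) : (leb R).-integrable J (EFin \o f) ->
    \int[leb R]_(t in J) f t = \int[leb R]_(t in J `\` E) f t + \int[leb R]_(t in E) f t.
  by move=> jf; rewrite -Rintegral_setU -?JE.
rewrite !split_int // [leRHS]addrCA -RintegralD //; last exact: integrableS ihJ.
apply: lerD.
  apply: le_Rintegral => //; [exact: integrableS icJ|exact: integrableS ihJ|].
  move=> x [Jx nEx]; apply: ltW; apply: contrapT => nh; apply: nEx; split => //.
  by split; [exact: JI|split; [exact: uvG|move=> -[_]; exact: nh]].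
apply: le_Rintegral => //; first exact: integrableS icJ.
  rewrite (_ : EFin \o _ = (EFin \o k i) \+ (EFin \o h)) //.
  by apply: integrableD => //; exact: integrableS ihJ.
move=> x _; rewrite /k.
have := ler_norm (c i); have := ler_norm (- h x); rewrite normrN; lra.
Qed.

(** In the constant, [2 * (b - a)] comes from losing [e] per unit length in the difference quotient
    and [e] in choosing [c i] just below [h t]; 2 bounds the weight [w] in units of [e], and 1
    bounds the variation of [F] over intervals tagged in the exceptional set. *)
Let approx (e : R) : 0 < e ->
  F b - F a <= \int[leb R]_(t in (`]a, b]%classic : set R)) h t + e * (2 * (b - a) + 3).
Proof.
move=> e0.
have [dac dac0 Hac] := abs_continuous_intervals acF e0.
have [|del del0 Hdel] := integral_abs_continuous mI (integrable_norm ih) _ e0.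
  by move=> t _; exact: normr_ge0.
case: Fh => B [mB B0 NB].
(* [GN] must be small twice: for the variation of [F] ([dac]) and for the integral of [|h|]
   ([del]). *)
have mdel0 : 0 < Num.min dac del by rewrite lt_min dac0.
have [|GN [oGN BGN mGN GNlt]] := lebR_regularity_outer mB _ mdel0.
  by rewrite B0.
(* [B] is null, so the bound on the part of [GN] outside [B] also bounds [GN]. *)
have {}GNlt : (leb R GN < (Num.min dac del)%:E)%E.
  apply: le_lt_trans GNlt; rewrite -[leRHS]adde0 -B0.
  apply: le_trans (measureU2 _ _ _) => //; last exact: measurableD.
  by rewrite le_measure ?inE //; [exact: measurableU (measurableD _ _) _|
     move=> x Gx; have [?|?] := pselect (B x); [right|left]].
have [G HG] := superlevel_open_cover e0.
pose D i : set (lebR R) := I `&` (G i `\` A i).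
have mD i : measurable (D i).
  by have [_ mG _ _] := HG i; apply: measurableI => //; exact: measurableD.
pose J (u v : R) : set (lebR R) := `]u, v]%classic.
have mJ u v : measurable (J u v) by exact: mitv.
have JI u v : a <= u -> v <= b -> J u v `<=` I.
  move=> au vb x; rewrite /J /I /= !in_itv /= => /andP[ux xv].
  by rewrite (le_trans xv) // andbT (le_trans au) // ltW.
pose wk u v i : \bar R := (\int[leb R]_(t in J u v `&` D i) (k i t)%:E)%E.
pose wN u v : \bar R := (\int[leb R]_(t in J u v `&` GN) `|h t|%:E)%E.
have wk0 u v i : (0 <= wk u v i)%E.
  by apply: integral_ge0 => t _; rewrite lee_fin addr_ge0.
have wN0 u v : (0 <= wN u v)%E.
  by apply: integral_ge0 => t _; rewrite lee_fin.
(* The total error weight. It is additive over adjacent intervals, so a local estimate with error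
   [w u v] survives gluing, and it is at most [2 * e] on []a, b]]. *)
pose w u v : \bar R := (\sum_(i <oo) wk u v i + wN u v)%E.
have wD u v z : a <= u -> u <= v -> v <= z -> z <= b -> (w u v + w v z = w u z)%E.
  move=> au uv vz zb; rewrite /w addeACA -nneseriesD //; congr (_ + _)%E.
    apply: eq_eseriesr => i _; apply/esym.
    apply: (ge0_integral_oc_split (mD i) mI) => //; first exact: JI.
    by move=> x _; rewrite addr_ge0.
  by apply/esym; apply: (ge0_integral_oc_split mGN mI) => //; exact: JI.
have w_le : (w a b <= (2 * e)%:E)%E.
  rewrite /w mulr2n mulrDl mul1r EFinD; apply: leeD.
    apply: le_trans (epsilon_trick0 xpredT (ltW e0)).
    apply: lee_nneseries => // i _; have [_ _ _] := HG i; apply: le_trans.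
    apply: ge0_subset_integral => //; [exact: measurableI|exact: mD| |].
    - by apply/measurable_EFinP; apply: measurable_funS (mk i) => // x [].
    - by move=> t _; rewrite lee_fin addr_ge0.
  apply: Hdel; first exact: measurableI.
    by move=> x [Jx _]; apply: (JI a b).
  apply: (@le_lt_trans _ _ (leb R GN)).
    by rewrite le_measure ?inE //; exact: measurableI.
  by apply: lt_le_trans GNlt _; rewrite lee_fin ge_min lexx orbT.
(* The list s collects the intervals tagged in the exceptional null set B; they
   lie in GN, which has small measure, so absolute continuity of F applies. *)
pose Q u v := exists s, [/\ intervals_in u v s,
  ((\sum_(X <- s) (X.2 - X.1))%:E <= leb R (J u v `&` GN))%E &
  ((F v - F u - \int[leb R]_(t in J u v) h t - 2 * e * (v - u)
     - \sum_(X <- s) `|F X.2 - F X.1|)%:E <= w u v)%E].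
suff [s [ins sumlt Hs]] : Q a b.
  have : (\sum_(X <- s) `|F X.2 - F X.1|) < e.
    apply: (Hac a b) => //; rewrite -lte_fin; apply: le_lt_trans sumlt _.
    apply: (@le_lt_trans _ _ (leb R GN)).
      by rewrite le_measure ?inE //; exact: measurableI.
    by apply: lt_le_trans GNlt _; rewrite lee_fin ge_min lexx.
  move: (le_trans Hs w_le); rewrite lee_fin -/(J a b).
  move=> H1 /ltW H2; have := lerD H1 H2; rewrite subrK lerBlDr lerBlDr.
  by move=> /le_trans; apply; rewrite le_eqVlt; apply/orP; left; apply/eqP; ring.
have ihJ u v : a <= u -> v <= b -> (leb R).-integrable (J u v) (EFin \o h).
  by move=> au vb; apply: integrableS ih => //; exact: JI.
have QD u v z : a <= u -> u <= v -> v <= z -> z <= b -> Q u v -> Q v z -> Q u z.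
  move=> au uv vz zb [s1 [in1 le1 w1]] [s2 [in2 le2 w2]].
  have Juz : J u z = J u v `|` J v z by rewrite /J -itv_bndbnd_setU.
  have disJ : J u v `&` J v z = set0.
    rewrite -subset0 => x []; rewrite /J /= !in_itv /=.
    by move=> /andP[_ xv] /andP[vx _]; rewrite ltNge xv in vx.
  exists (s1 ++ s2); split; first exact: intervals_in_cat in1 in2.
    rewrite big_cat /= EFinD Juz setIUl measureU;
      [exact: leeD|exact: measurableI|exact: measurableI|].
    by rewrite setIACA disJ set0I.
  rewrite -(wD u v z) //; apply: le_trans (leeD w1 w2).
  rewrite -EFinD lee_fin big_cat /= Juz Rintegral_setU //.
  - by rewrite le_eqVlt; apply/orP; left; apply/eqP; ring.
  - by rewrite -Juz; apply: ihJ.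
  - by apply/eqP.
apply: cousin_ind => // t tab.
have [Bt|nBt] := pselect (B t).
  have /nbhs_ballP[r /= r0 Hr] : nbhs t GN by apply: open_nbhs_nbhs; split => //; exact: BGN.
  exists r => // u v au ut tv vb ru rv.
  have JG : J u v `<=` GN by apply: subset_trans Hr; exact: oc_subset_ball.
  have uv : u <= v by exact: le_trans tv.
  (* The listed term [|F v - F u|] absorbs the increment of [F]; what is left is at most minus the
     integral of [h], hence at most [wN u v] because []u, v]] lies in [GN]. *)
  exists [:: (u, v)]; split.
  - by rewrite /intervals_in /= !lexx uv.
  - by rewrite big_seq1 /= setIidl // [leRHS](leb_itv_oc uv).
  rewrite big_seq1 /=; apply: (@le_trans _ _ (wN u v)); last first.
    by apply: leeDr; apply: nneseries_ge0 => i _ _.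
  rewrite /wN setIidl //.
  have -> : (\int[leb R]_(x in J u v) `|h x|%:E = (\int[leb R]_(x in J u v) `|h x|)%:E)%E.
    by rewrite fineK //; apply: integrable_fin_num => //; apply: integrable_norm; exact: ihJ.
  rewrite lee_fin; apply: le_trans (le_normr_Rintegral (mJ u v) (ihJ u v au vb)).
  apply: (@le_trans _ _ (- \int[leb R]_(x in J u v) h x)); last by rewrite -normrN ler_norm.
  rewrite lerBlDr addrC -subr_ge0.
  rewrite (_ : _ - _ = `|F v - F u| - (F v - F u) + 2 * e * (v - u)); last ring.
  rewrite addr_ge0 ?subr_ge0 ?ler_norm // !mulr_ge0 ?subr_ge0 //; exact: ltW.
have [dF dFt dFh] : exists2 dF : R, is_derive t 1 F dF & dF <= h t.
  by apply: contrapT => nP; apply: nBt; apply: NB => /(_ tab).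
(* With [h t - e < c i < h t] the tag lies in [A i], hence in the open set [G i], and [dF + e] is at
   most [c i + 2 * e]. *)
have [|i /andP[ci hi]] := c_dense (x := h t - e) (y := h t); first by rewrite gtrBl.
have [oG mG AG _] := HG i.
have /nbhs_ballP[r1 /= r10 Hr1] : nbhs t (G i).
  apply: open_nbhs_nbhs; split => //; apply: AG; split => //=.
have [r2 r20 Hr2] := is_derive_increment_le dFt e0.
exists (Num.min r1 r2); first by rewrite lt_min r10.
move=> u v au ut tv vb ru rv.
have uv : u <= v by exact: le_trans tv.
have m1 : Num.min r1 r2 <= r1 by rewrite ge_min lexx.
have m2 : Num.min r1 r2 <= r2 by rewrite ge_min lexx orbT.
have ru1 : t - r1 < u by apply: le_lt_trans ru; rewrite lerD2l lerN2.
have rv1 : v < t + r1 by apply: lt_le_trans rv _; rewrite lerD2l.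
have ru2 : t - r2 < u by apply: le_lt_trans ru; rewrite lerD2l lerN2.
have rv2 : v < t + r2 by apply: lt_le_trans rv _; rewrite lerD2l.
have JG : J u v `<=` G i by apply: subset_trans Hr1; exact: oc_subset_ball.
exists [::]; split => //; first by rewrite big_nil measure_ge0.
apply: (@le_trans _ _ (wk u v i)).
  apply: le_trans (superlevel_const_le i au uv vb mG JG).
  rewrite lee_fin big_nil subr0 -/(J u v) addrAC lerB //.
  rewrite lerBlDr -mulrDl; apply: (le_trans (Hr2 u v ut tv ru2 rv2)).
  rewrite ler_wpM2r ?subr_ge0 // [2 * e]mulr_natl mulr2n addrA lerD2r.
  by rewrite -lerBlDr (le_trans _ (ltW ci)) // lerB.
rewrite /w; apply: (@le_trans _ _ (\sum_(i <oo) wk u v i)%E); last exact: leeDl.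
by rewrite (@nneseriesD1 _ _ i) //; apply: leeDl; exact: nneseries_ge0.
Qed.

Lemma abs_continuous_le_integral :
  F b - F a <= \int[leb R]_(t in (`]a, b]%classic : set R)) h t.
Proof.
apply/ler_addgt0Pr => e e0.
have K0 : 0 < 2 * (b - a) + 3 by rewrite ltr_wpDl // mulr_ge0 // subr_ge0.
by have := approx (divr_gt0 e0 K0); rewrite divfK // gt_eqF.
Qed.

End abs_continuous_le_integral.

(** * Inner products, gradients and concavity *)

Lemma dotDl (R : realType) n (a b c : 'rV[R]_n) : dot (a + b) c = dot a c + dot b c.
Proof. by rewrite -big_split; apply: eq_bigr => i _; rewrite mxE mulrDl. Qed.

Lemma dotDr (R : realType) n (a b c : 'rV[R]_n) : dot a (b + c) = dot a b + dot a c.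
Proof. by rewrite -big_split; apply: eq_bigr => i _; rewrite mxE mulrDr. Qed.

Lemma dotZl (R : realType) n k (a b : 'rV[R]_n) : dot (k *: a) b = k * dot a b.
Proof. by rewrite mulr_sumr; apply: eq_bigr => i _; rewrite mxE mulrA. Qed.

Lemma dotZr (R : realType) n k (a b : 'rV[R]_n) : dot a (k *: b) = k * dot a b.
Proof. by rewrite mulr_sumr; apply: eq_bigr => i _; rewrite mxE mulrCA. Qed.

Lemma dotNl (R : realType) n (a b : 'rV[R]_n) : dot (- a) b = - dot a b.
Proof. by rewrite -scaleN1r dotZl mulN1r. Qed.

Lemma dotNr (R : realType) n (a b : 'rV[R]_n) : dot a (- b) = - dot a b.
Proof. by rewrite -scaleN1r dotZr mulN1r. Qed.

Lemma dot0l (R : realType) n (b : 'rV[R]_n) : dot 0 b = 0.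
Proof. by rewrite -(scale0r 0) dotZl mul0r. Qed.

Lemma dot0r (R : realType) n (b : 'rV[R]_n) : dot b 0 = 0.
Proof. by rewrite -(scale0r 0) dotZr mul0r. Qed.

Lemma dot_suml (R : realType) n (I : Type) (s : seq I) (F : I -> 'rV[R]_n) b :
  dot (\sum_(i <- s) F i) b = \sum_(i <- s) dot (F i) b.
Proof.
by elim/big_ind2 : _ => [|? ? ? ? <- <-|//]; [exact: dot0l|exact: dotDl].
Qed.

Lemma coord_le_norm (R : realType) n (a : 'rV[R]_n) i : `|a 0 i| <= `|a|.
Proof.
rewrite [leRHS]/Num.Def.normr/= mx_normrE.
exact: (le_bigmax _ (fun ij : 'I_1 * 'I_n => `|a ij.1 ij.2|) (0, i)).
Qed.

Lemma norm_dot_le (R : realType) n (a b : 'rV[R]_n) :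
  `|dot a b| <= n%:R * (`|a| * `|b|).
Proof.
apply: (le_trans (ler_norm_sum _ _ _)).
have -> : n%:R * (`|a| * `|b|) = \sum_(i < n) `|a| * `|b|.
  by rewrite sumr_const card_ord mulr_natl.
apply: ler_sum => i _.
by rewrite normrM; apply: ler_pM => //; exact: coord_le_norm.
Qed.

Lemma cvg_dot (R : realType) n (T : Type) (F : set_system T) (a b : T -> 'rV[R]_n)
    (x y : 'rV[R]_n) : Filter F ->
  a t @[t --> F] --> x -> b t @[t --> F] --> y ->
  dot (a t) (b t) @[t --> F] --> dot x y.
Proof.
move=> FF ax byy; rewrite /dot; apply: cvg_big => [|i _]; first exact: add_continuous.
apply: cvgM.
  exact: (cvg_comp _ _ ax (@coord_continuous _ _ _ 0 i x)).
exact: (cvg_comp _ _ byy (@coord_continuous _ _ _ 0 i y)).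
Qed.

Lemma is_derive_coord (R : realType) n (a : R -> 'rV[R]_n) (t : R) (da : 'rV[R]_n) i :
  is_derive t 1 a da -> is_derive t 1 (fun r => a r 0 i) (da 0 i).
Proof.
move=> [dva <-]; apply: DeriveDef.
  by have /derivable_mxP := dva; apply.
by rewrite derive_mx // mxE.
Qed.

Lemma is_derive_dot (R : realType) n (a b : R -> 'rV[R]_n) (t : R) (da db : 'rV[R]_n) :
  is_derive t 1 a da -> is_derive t 1 b db ->
  is_derive t 1 (fun r => dot (a r) (b r)) (dot da (b t) + dot (a t) db).
Proof.
move=> Ha Hb.
rewrite (_ : (fun r => _) = \sum_(i < n) ((fun r => a r 0 i) * (fun r => b r 0 i))); last first.
  by apply/funext => r; rewrite fct_sumE.
apply: is_derive_eq.
  apply: is_derive_sum => i; apply: is_deriveM; exact: is_derive_coord.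
rewrite -big_split /=; apply: eq_bigr => i _.
by rewrite addrC [_ *: da _ _]mulrC.
Qed.

Lemma abs_continuous_bounded_dot (R : realType) n (D : set R) (a b : R -> 'rV[R]_n) (M : R) :
  (forall t, D t -> `|a t| <= M) -> (forall t, D t -> `|b t| <= M) ->
  abs_continuous_on D a -> abs_continuous_on D b ->
  abs_continuous_on D (fun t => dot (a t) (b t)).
Proof.
move=> aM bM aca acb e e0.
(* The absolute value is there because [M] carries no sign assumption, and the added 1 keeps [K]
   positive when [n] or [M] is 0. *)
pose K := n%:R * `|M| + 1; have K0 : 0 < K by rewrite ltr_wpDl // mulr_ge0.
have eK : 0 < e / 2 / K by rewrite !divr_gt0.
have [d1 d10 H1] := aca _ eK; have [d2 d20 H2] := acb _ eK.
exists (Num.min d1 d2); first by rewrite lt_min d10.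
move=> q u v uv tI; rewrite lt_min => /andP[/(H1 _ _ _ uv tI) {}H1 /(H2 _ _ _ uv tI) {}H2].
apply: (@le_lt_trans _ _ (\sum_(i < q) (K * `|a (v i) - a (u i)| + K * `|b (v i) - b (u i)|))).
  apply: ler_sum => i _; have [Du Dv _] := uv i.
  have -> : dot (a (v i)) (b (v i)) - dot (a (u i)) (b (u i)) =
      dot (a (v i) - a (u i)) (b (v i)) + dot (a (u i)) (b (v i) - b (u i)).
    rewrite dotDl dotDr !dotNl dotNr; lra.
  apply: (le_trans (ler_normD _ _)); apply: lerD; apply: (le_trans (norm_dot_le _ _)).
    rewrite mulrCA mulrC ler_wpM2r // (@le_trans _ _ (n%:R * `|M|)) //; last by rewrite lerDl.
    by rewrite ler_wpM2l // (le_trans (bM _ Dv)) // ler_norm.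
  rewrite mulrA ler_wpM2r // (@le_trans _ _ (n%:R * `|M|)) //; last by rewrite lerDl.
  by rewrite ler_wpM2l // (le_trans (aM _ Du)) // ler_norm.
rewrite big_split /= -!mulr_sumr.
move: H1 H2; rewrite !ltr_pdivlMr // => H1 H2.
rewrite [K * _]mulrC [in X in _ + X]mulrC; lra.
Qed.

(** The derivative exists, so it is approximated by the quotient at a single small positive [a]. *)
Lemma derive_le_slope (R : realType) (V : normedModType R) (g : V -> R) (y v : V) (K : R) :
  derivable g y v -> (forall a : R, 0 < a <= 1 -> g (a *: v + y) - g y <= a * K) ->
  'D_v g y <= K.
Proof.
move=> dg H; apply/ler_addgt0Pr => e e0.
have /cvgrPdist_le /(_ _ e0) := dg; rewrite -/('D_v g y) => -[r /= r0 Hr].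
pose a := Num.min (r / 2) 1.
have a0 : 0 < a by rewrite lt_min divr_gt0 //=.
have a1 : a <= 1 by rewrite ge_min lexx orbT.
have ar : a < r by rewrite (@le_lt_trans _ _ (r / 2)) ?ge_min ?lexx //; lra.
have := Hr a; rewrite /= sub0r normrN gtr0_norm // => /(_ ar (lt0r_neq0 a0)).
rewrite ler_norml => /andP[_ le1].
have : a^-1 * (g (a *: v + y) - g y) <= K.
  by rewrite ler_pdivrMl // H // a0.
move: le1; rewrite -[_ *: _]/(a^-1 * (g (a *: v + y) - g y)); lra.
Qed.

(** [grad] only collects partial derivatives; differentiability makes them represent every
    directional derivative. *)
Lemma derive_grad (R : realType) n (g : 'rV[R]_n -> R) (y v : 'rV[R]_n) :
  differentiable g y -> 'D_v g y = dot (grad g y) v.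
Proof.
move=> dg; rewrite deriveE // [in LHS](row_sum_delta v) linear_sum.
apply: eq_bigr => i _; rewrite linearZ /= !mxE deriveE //.
by rewrite -[LHS]/(v 0 i * 'd g y (delta_mx 0 i)) mulrC.
Qed.

Lemma differentiable_pontryagin (R : realType) n m l (P : ocp R n m l) (t : R)
    (y : 'rV[R]_n) (v : 'rV[R]_m) (q : 'rV[R]_n) (lam0 : R) :
  differentiable (fun z => ocp_f P t z v) y ->
  differentiable (fun z => ocp_phi P t z v) y ->
  differentiable (fun z => pontryagin P t z v q lam0) y.
Proof.
move=> df dphi.
rewrite (_ : (fun z => _) = (- lam0 * ocp_omega P t) *: (fun z => ocp_f P t z v) +
  \sum_(i < n) (q 0 i *: (fun z => ocp_phi P t z v 0 i))); last first.
  by apply/funext => z; rewrite /pontryagin /dot fctE fct_sumE.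
apply: differentiableD; first exact: differentiableZ.
apply: differentiable_sum => i; apply: differentiableZ.
apply: (differentiable_comp (f := fun z => ocp_phi P t z v)
  (g := fun z : 'rV[R]_n => z 0 i)) => //.
exact: differentiable_coord.
Qed.

Lemma pontryagin_le_grad (R : realType) n m l (P : ocp R n m l) (gamma t : R)
    (y d q : 'rV[R]_n) (v vs : 'rV[R]_m) :
  concave_on [set z | `|z - y| <= gamma] (fun z => hamiltonian P t z q) ->
  `|d| <= gamma -> ocp_U P v -> ocp_U P vs ->
  (forall w, ocp_U P w -> pontryagin P t y w q 1 <= pontryagin P t y vs q 1) ->
  differentiable (fun z => pontryagin P t z vs q 1) y ->
  pontryagin P t (y + d) v q 1 - pontryagin P t y vs q 1 <=
    dot (grad (fun z => pontryagin P t z vs q 1) y) d.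
Proof.
move=> conc dg Uv Uvs maxvs diff.
rewrite -lerN2 -dotNr -derive_grad // opprB.
apply: derive_le_slope; first exact: diff_derivable.
move=> a /andP[a0 a1].
set H := fun z => pontryagin P t z vs q 1; set Hv := pontryagin P t (y + d) v q 1.
have a10 : 0 < 1 + a by rewrite addr_gt0.
(* y is the convex combination of y + d and y - a d with weight b on y + d. *)
pose b := a / (1 + a).
have b01 : 0 <= b <= 1.
  by rewrite ler_pdivrMr // mul1r lerDr ler01 andbT divr_ge0 // ltW.
have [c1 [bE bE']] : [/\ 1 - b = (1 + a)^-1, b * (1 + a) = a & (1 - b) * (1 + a) = 1].
  rewrite /b; split; [field | rewrite divfK // | ]; rewrite ?gt_eqF //.
  by rewrite mulrBl mul1r divfK ?gt_eqF // addrK.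
have D1 : `|y + d - y| <= gamma by rewrite addrAC subrr add0r.
have D2 : `|a *: - d + y - y| <= gamma.
  by rewrite addrK normrZ normrN gtr0_norm // (le_trans _ dg) // ler_piMl.
have E : b *: (y + d) + (1 - b) *: (a *: - d + y) = y.
  rewrite !scalerDr [b *: y + _]addrC addrACA -scalerDl addrC [b + _]addrC subrK scale1r.
  rewrite !scalerN scalerA -scalerBl (_ : b - _ = 0) ?scale0r ?addr0 //.
  by rewrite c1 /b mulrC subrr.
have := conc _ _ b D1 D2 b01; rewrite E.
move=> Hle.
(* The maximum condition bounds the Hamiltonian from above at [y]. At the two outer points, where it
   may be infinite, only lower bounds are used. *)
have Hy : (hamiltonian P t y q <= (H y)%:E)%E.
  by apply: ge_ereal_sup => _ [w Uw <-]; rewrite lee_fin; exact: maxvs.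
have {}Hle : (b%:E * Hv%:E + (1 - b)%:E * (H (a *: - d + y))%:E <= (H y)%:E)%E.
  apply: le_trans Hy; apply: le_trans Hle; apply: leeD; apply: lee_wpmul2l.
  - by rewrite lee_fin; case/andP : b01.
  - by apply: ereal_sup_ubound; exists v.
  - by rewrite lee_fin subr_ge0; case/andP : b01.
  - by apply: ereal_sup_ubound; exists vs.
move: Hle; rewrite -!EFinM -EFinD lee_fin -(ler_pM2r a10) mulrDl.
rewrite -/(H y) [b * Hv * _]mulrAC bE [_ * _ * (1 + a)]mulrAC bE' mul1r.
rewrite -lerBrDl => Hle; rewrite lerBlDr (le_trans Hle) //.
by rewrite le_eqVlt; apply/orP; left; apply/eqP; ring.
Qed.

(** Tangent inequality: by convexity all difference quotients at [y] in direction [d] with step at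
    most 1 are bounded by the increment over the full step. *)
Lemma convex_grad_le (R : realType) n (gamma : R) (y d : 'rV[R]_n) (g : 'rV[R]_n -> R) :
  convex_function ([set z | `|z - y| <= gamma] : set (convex_lmodType 'rV[R]_n)) g ->
  `|d| <= gamma -> differentiable g y ->
  dot (grad g y) d <= g (y + d) - g y.
Proof.
move=> conv dg diff; rewrite -derive_grad //.
apply: derive_le_slope; first exact: diff_derivable.
move=> a /andP[a0 a1].
have a01 : Itv.spec (Itv.num_sem (R:=R)) (Itv.Real `[0%Z, 1%Z]) a.
  by rewrite /Itv.spec /= /Itv.num_sem /= num_real in_itv /= ltW.
pose a' : {i01 R} := Itv.mk a01.
have H : g (a *: (y + d) + (1 - a) *: y) <= a * g (y + d) + (1 - a) * g y.
  apply: (conv a' (y + d) y); rewrite inE /=; first by rewrite addrAC subrr add0r.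
  by rewrite subrr normr0 (le_trans _ dg).
have E : a *: (y + d) + (1 - a) *: y = a *: d + y.
  by rewrite scalerDr [a *: y + _]addrC -addrA -scalerDl [a + _]addrC subrK scale1r.
rewrite E in H; rewrite lerBlDr (le_trans H) //.
by rewrite le_eqVlt; apply/orP; left; apply/eqP; ring.
Qed.

(** * Limits at infinity and at the jump times *)

Lemma cvg_row (R : realType) n (T : Type) (F : set_system T) (a : T -> 'rV[R]_n)
    (x : 'rV[R]_n) : Filter F ->
  (forall i, a t 0 i @[t --> F] --> x 0 i) -> a t @[t --> F] --> x.
Proof.
move=> FF H; apply/cvgrPdist_le => /= e e0; near=> t.
rewrite /Num.Def.normr /= mx_normrE (bigmax_le _ (ltW e0)) //= => -[i j] _.
rewrite !mxE /= (ord1 i); move: j; near: t; apply: filter_forall => /= j.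
exact: ((cvgrPdist_le _ _).1 (H j)).
Unshelve. all: by end_near. Qed.

(** Both [(t, x t)] and the point at infinity [(+oo, lim x)] lie on the axis of the tube and become
    close as [t] grows, so uniform continuity of the extension gives the limit. *)
Lemma unif_continuous_tube_cvg (R : realType) n m (W : normedModType R)
    (x : R -> 'rV[R]_n) (gamma : R) (U1 : set 'rV[R]_m)
    (h : R -> 'rV[R]_n -> 'rV[R]_m -> W) (v : 'rV[R]_m) :
  0 < gamma -> U1 v -> cvg (x t @[t --> +oo]) -> unif_continuous_tube x gamma U1 h ->
  cvg (h t (x t) v @[t --> +oo]).
Proof.
move=> g0 Uv cx [_ uc].
apply/cvg_ex; exists (ext_oo (fun t => h t (lim (x t @[t --> +oo])) v) (+oo%E)).
apply/cvgrPdist_lt => e e0; have [d d0 H] := uc e e0.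
have poo : \forall t \near +oo, ball (+oo%E : \bar R) d (t%:E : \bar R).
  have : (t%:E : \bar R) @[t --> +oo] --> (+oo%E : \bar R) by apply/cvgeryP.
  by move/(_ (ball (+oo%E : \bar R) d)); apply; exact: nbhsx_ballx.
near=> t.
have := H ((+oo%E : \bar R), lim (x t @[t --> +oo]), v) (t%:E, x t, v).
rewrite /= -ball_normE; apply.
- by split => //; split => //=; rewrite subrr normr0 ltW.
- split => //; split => /=; last by rewrite subrr normr0 ltW.
  by rewrite lee_fin; near: t; exact: nbhs_pinfty_ge.
- split; last exact: ballxx.
  split => /=; first by near: t.
  rewrite -ball_normE /=; near: t.
  by have /cvgrPdist_lt := cx; apply.
Unshelve. all: by end_near. Qed.

Lemma Rintegral_oc_split (R : realType) (h : R -> R) (u v w : R) : u <= v -> v <= w ->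
  (leb R).-integrable (`]u, w]%classic : set R) (EFin \o h) ->
  \int[leb R]_(t in (`]u, w]%classic : set R)) h t =
  \int[leb R]_(t in (`]u, v]%classic : set R)) h t +
  \int[leb R]_(t in (`]v, w]%classic : set R)) h t.
Proof.
move=> uv vw ih.
have mi := @measurable_itv_lebR R.
have E : `]u, w]%classic = `]u, v]%classic `|` `]v, w]%classic by rewrite -itv_bndbnd_setU.
rewrite E Rintegral_setU //; first by rewrite -E.
apply/eqP; rewrite -subset0 => x [] /=; rewrite !in_itv /=.
by move=> /andP[_ xv] /andP[vx _]; rewrite ltNge xv in vx.
Qed.

(** Passes from compact subintervals to one-sided limits at the ends, so that a jump of [F] at [a]
    can be accounted for separately. *)
Lemma increment_le_integral_lim (R : realType) (F h : R -> R) (a b A B : R) : a < b ->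
  (leb R).-integrable (`]a, b]%classic : set R) (EFin \o h) ->
  F t @[t --> a^'+] --> A -> F t @[t --> b^'-] --> B ->
  (forall c d, a < c -> c <= d -> d < b ->
    F d - F c <= \int[leb R]_(t in (`]c, d]%classic : set R)) h t) ->
  B - A <= \int[leb R]_(t in (`]a, b]%classic : set R)) h t.
Proof.
move=> ab ih Fa Fb H.
have mi := @measurable_itv_lebR R.
(* Four errors of [e / 4]: two one-sided limits and the integrals over the two end pieces. The
   midpoint below keeps [c] left of [d]. *)
apply/ler_addgt0Pr => e e0; have e40 : 0 < e / 4 by rewrite divr_gt0.
have [|del del0 Hdel] := integral_abs_continuous (mi _) (integrable_norm ih) _ e40.
  by move=> t _; exact: normr_ge0.
have small u v : a <= u -> u <= v -> v <= b -> v - u < del ->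
    - (e / 4) <= \int[leb R]_(t in (`]u, v]%classic : set R)) h t.
  move=> au uv vb vudel.
  have sub : `]u, v]%classic `<=` `]a, b]%classic.
    by apply: subset_itv; rewrite bnd_simp.
  have ihuv : (leb R).-integrable (`]u, v]%classic : set R) (EFin \o h).
    exact: integrableS ih.
  have := Hdel `]u, v]%classic (mi _) sub.
  rewrite [X in (X < _)%E](leb_itv_oc uv) lte_fin => /(_ vudel).
  rewrite -[X in (X <= _)%E]fineK; last first.
    by apply: integrable_fin_num => //; exact: integrable_norm.
  rewrite lee_fin => le4; rewrite lerNl; apply: le_trans le4.
  apply: le_trans (le_normr_Rintegral (mi _) ihuv).
  by rewrite -normrN ler_norm.
have [c [ac cab cdel Fc]] : exists c,
    [/\ a < c, c < (a + b) / 2, c - a < del & F c <= A + e / 4].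
  near (a^'+) => c; exists c; split.
  - by near: c; exact: nbhs_right_gt.
  - by near: c; apply: nbhs_right_lt; lra.
  - by near: c; exact: nbhs_right_ltDr.
  - have : `|A - F c| <= e / 4.
      by near: c; have /cvgrPdist_le := Fa; apply.
    rewrite ler_norml => /andP[]; lra.
have [d [dab db ddel Fd]] : exists d,
    [/\ (a + b) / 2 < d, d < b, b - d < del & B - e / 4 <= F d].
  near (b^'-) => d; exists d; split.
  - by near: d; apply: nbhs_left_gt; lra.
  - by near: d; exact: nbhs_left_lt.
  - by near: d; exact: nbhs_left_ltBl.
  - have : `|B - F d| <= e / 4.
      by near: d; have /cvgrPdist_le := Fb; apply.
    rewrite ler_norml => /andP[]; lra.
have cd : c < d by exact: lt_trans dab.
rewrite (Rintegral_oc_split (ltW ac) (ltW (lt_trans cd db)) ih).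
rewrite (Rintegral_oc_split (ltW cd) (ltW db)); last first.
  by apply: integrableS ih => //; apply: subset_itv; rewrite bnd_simp // ltW.
have h1 := small a c (lexx _) (ltW ac) (ltW (lt_trans cd db)) cdel.
have h2 := small d b (ltW (lt_trans ac cd)) (ltW db) (lexx _) ddel.
have h3 := H c d ac (ltW cd) db.
move: (Rintegral _ _ _) (Rintegral _ _ _) (Rintegral _ _ _) h1 h2 h3 => x y z h1 h2 h3.
clear - h1 h2 h3 Fc Fd; lra.
Unshelve. all: by end_near. Qed.

Lemma measurable_Rplus (R : realType) : measurable (Rplus R).
Proof.
rewrite (_ : Rplus R = `[0, +oo[%classic).
  exact: measurable_itv_lebR.
by apply/seteqP; split => x; rewrite /Rplus /= in_itv /= andbT.
Qed.
Arguments measurable_Rplus {R}.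

(** Dominated convergence for [h] restricted to []0, s k]], with dominating function [|h|]. *)
Lemma Rintegral_Rplus_ge (R : realType) (h : R -> R) (s v : nat -> R) (V : R) :
  L1 h -> s k @[k --> \oo] --> +oo -> v k @[k --> \oo] --> V ->
  (forall k, v k <= \int[leb R]_(t in (`]0, s k]%classic : set R)) h t) ->
  V <= \int[leb R]_(t in Rplus R) h t.
Proof.
move=> ih soo vV H.
have mi := @measurable_itv_lebR R.
(* The point 0, missing from every []0, s k]], is a null set and is removed first. *)
pose D : set (lebR R) := `]0, +oo[%classic.
have RD : Rplus R `\` [set 0] = D.
  apply/seteqP; split => x; rewrite /Rplus /D /= in_itv /= andbT.
    by move=> [x0 /eqP xn0]; rewrite lt_neqAle eq_sym xn0.
  by move=> x0; split; [exact: ltW|apply/eqP; rewrite gt_eqF].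
have m0 : measurable ([set (0 : R)] : set (lebR R)) by exact: measurable_lebR.
have DR : D `<=` Rplus R by rewrite -RD; exact: subDsetl.
have ihD : (leb R).-integrable D (EFin \o h).
  by exact: (integrableS measurable_Rplus (mi _) DR ih).
have -> : \int[leb R]_(t in Rplus R) h t = \int[leb R]_(t in D) h t.
  rewrite /Rintegral (negligible_integral m0 measurable_Rplus ih) ?RD //.
  exact: (lebesgue_measure_set1 (0 : R)).
have JD k : D `&` `]0, s k]%classic = `]0, s k]%classic.
  rewrite setIidr //; apply: subset_trans (_ : `]0, +oo[ `<=` D) => //.
  exact: subset_itvl.
have := @dominated_convergence _ _ _ (leb R) D (mi _)
  (fun k => (EFin \o h) \_ `]0, s k]%classic) (EFin \o h) (EFin \o (fun t => `|h t|)).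
case.
- move=> k; apply/(measurable_restrict _ (mi _) (mi _)).
  by apply: (measurable_funS (mi _) _ (measurable_int _ ihD)) => x [].
- exact: measurable_int ihD.
- apply: aeW => x Dx; apply: cvg_near_cst; near=> k.
  rewrite patchE ifT // inE /= in_itv /=.
  move: Dx; rewrite /D /= in_itv /= andbT => -> /=.
  by near: k; have /cvgryPge := soo; apply.
- exact: integrable_norm.
- apply: aeW => x k Dx; rewrite patchE; case: ifP => _ //=.
  by rewrite lee_fin normr0.
move=> _ _; rewrite -[X in _ --> X]fineK; last exact: (integrable_fin_num (mi _) ihD).
move=> /fine_cvg intcvg.
apply: (ler_cvg_to vV intcvg).
apply: nearW => k; apply: le_trans (H k) _.
by rewrite /Rintegral /= -integral_mkcondr JD.
Unshelve. all: by end_near. Qed.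

(** * Absolutely continuous functions: continuity and boundedness *)

Lemma abs_continuousS (R : realType) (V : normedModType R) (D E : set R) (h : R -> V) :
  E `<=` D -> abs_continuous_on D h -> abs_continuous_on E h.
Proof.
move=> ED ac e /ac[d d0 H]; exists d => // q a b ab; apply: H => i.
by have [/ED ? /ED ? ?] := ab i.
Qed.

Lemma abs_continuousB (R : realType) (V : normedModType R) (D : set R) (g h : R -> V) :
  abs_continuous_on D g -> abs_continuous_on D h ->
  abs_continuous_on D (fun t => g t - h t).
Proof.
move=> acg ach e e0; have e20 : 0 < e / 2 by rewrite divr_gt0.
have [d1 d10 H1] := acg _ e20; have [d2 d20 H2] := ach _ e20.
exists (Num.min d1 d2); first by rewrite lt_min d10.
move=> q u v uv tI; rewrite lt_min => /andP[/(H1 _ _ _ uv tI) {}H1 /(H2 _ _ _ uv tI) {}H2].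
rewrite [e]splitr; apply: le_lt_trans (ltrD H1 H2).
rewrite -big_split; apply: ler_sum => i _ /=.
have -> : g (v i) - h (v i) - (g (u i) - h (u i)) =
    g (v i) - g (u i) - (h (v i) - h (u i)).
  by rewrite !opprB ![h (u i) - _]addrC addrACA.
exact: ler_normB.
Qed.

(** Absolute continuity is applied to the single interval between [t] and [r]. The filter is
    arbitrary so that two-sided and one-sided limits are both covered. *)
Lemma abs_continuous_cvg (R : realType) (V : normedModType R) (D : set R) (h : R -> V)
    (t : R) (G : set_system R) : Filter G ->
  abs_continuous_on D h -> D t -> (\forall r \near G, D r) -> r @[r --> G] --> t ->
  h r @[r --> G] --> h t.
Proof.
move=> FG ac Dt DG Gt; apply/cvgrPdist_lt => e e0.
have [d d0 H] := ac e e0.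
near=> r.
have Dr : D r by near: r.
have rd : `|t - r| < d by near: r; have /cvgrPdist_lt := Gt; apply.
have trivI (a b : R) : trivIset [set: 'I_1] (fun _ => `]a, b[%classic).
  by apply/trivIsetP => i j _ _; rewrite (ord1 i) (ord1 j) eqxx.
have [tr|/ltW rt] := leP t r.
  have := H 1 (fun=> t) (fun=> r); rewrite !big_ord1 distrC; apply => //.
  by rewrite -(ger0_norm (_ : 0 <= r - t)) ?subr_ge0 // distrC.
have := H 1 (fun=> r) (fun=> t); rewrite !big_ord1; apply => //.
by rewrite -(ger0_norm (_ : 0 <= t - r)) ?subr_ge0.
Unshelve. all: by end_near. Qed.

(** Supplies the bound on [p] between two jumps that [abs_continuous_bounded_dot] asks for, by the
    extreme value theorem. *)
Lemma abs_continuous_bounded (R : realType) (V : normedModType R) (a b c d : R) (h : R -> V) :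
  abs_continuous_on `]a, b[ h -> a < c -> c <= d -> d < b ->
  exists M, forall t, c <= t <= d -> `|h t| <= M.
Proof.
move=> ac lac cd db.
have cont : {within `[c, d], continuous (fun t => `|h t|)}.
  apply: continuous_in_subspaceT => t; rewrite inE /= in_itv /= => /andP[ct td].
  have tab : t \in `]a, b[ by rewrite in_itv /= (lt_le_trans lac) // (le_lt_trans td).
  apply: cvg_norm; apply: (@abs_continuous_cvg _ _ `]a, b[%classic h t (nbhs t)) => //.
  exact: near_in_itvoo.
have [r _ H] := EVT_max cd cont.
by exists `|h r| => t tcd; apply: H; rewrite in_itv.
Qed.

(** Here [gy] and [gz] stand for a constraint at the reference and at the competing trajectory. The
    same computation serves the densities [lam] and the jump weights [bet]. *)
Lemma slack_dot_le0 (R : realType) n (b gy gz : R) (a d : 'rV[R]_n) :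
  0 <= b -> b * gy = 0 -> gz <= 0 -> dot a d <= gz - gy -> dot (b *: a) d <= 0.
Proof.
move=> b0 bgy gz0 le1; rewrite dotZl; apply: (le_trans (ler_wpM2l b0 le1)).
by rewrite mulrBr bgy subr0 mulr_ge0_le0.
Qed.

(** * The sufficiency argument *)

Section verification.
Variables (R : realType) (n m l : nat) (P : ocp R n m l).
Variables (xs : R -> 'rV[R]_n) (us : R -> 'rV[R]_m) (p : R -> 'rV[R]_n).
Variables (s : nat -> R) (bet : 'I_l -> nat -> R) (lam : 'I_l -> R -> R).
Variables (gamma : R) (x : R -> 'rV[R]_n) (u : R -> 'rV[R]_m).
Hypothesis adms : admissible P xs us.
Hypothesis lip : A_Lip P xs us.
Hypothesis adj : piecewise_adjoint P xs us p s bet lam.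
Hypothesis maxH : {ae leb R, forall t : R, 0 <= t ->
  forall v, ocp_U P v ->
    pontryagin P t (xs t) v (p t) 1 <= pontryagin P t (xs t) (us t) (p t) 1}.
Hypothesis slack_jump : forall j k, bet j k * ocp_g P j (s k) (xs (s k)) = 0.
Hypothesis slack_lam : forall j k t, s k < t < s k.+1 -> lam j t * ocp_g P j t (xs t) = 0.
Hypothesis conc : forall t : R, 0 <= t ->
  concave_on [set y | `|y - xs t| <= gamma] (fun y => hamiltonian P t y (p t)).
Hypothesis conv : forall t : R, 0 <= t -> forall j, convex_function
  ([set y | `|y - xs t| <= gamma] : set (convex_lmodType 'rV[R]_n)) (ocp_g P j t).
Hypothesis adm : admissible P x u.
Hypothesis near_xs : forall t : R, 0 <= t -> `|x t - xs t| <= gamma.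

Let h (t : R) := cost_density P x u t - cost_density P xs us t.
Let F (t : R) := dot (p t) (x t - xs t).

Let s_ge0 k : 0 <= s k.
Proof.
elim: k => [|k IH]; first by rewrite (adj_s0 adj).
exact: (le_trans IH (ltW (adj_s_incr adj k))).
Qed.

Lemma in_tube (t : R) : 0 <= t -> forall g, 0 < g -> tube xs g (t%:E, xs t).
Proof.
by move=> t0 g g0; split => /=; [rewrite lee_fin|rewrite subrr normr0 ltW].
Qed.

(** [A_Lip] is applied to the compact singleton of [v]; the radius may depend on [v], but [xs t] is
    in every tube. *)
Lemma differentiable_data (t : R) v : 0 <= t ->
  [/\ differentiable (fun z => ocp_f P t z v) (xs t),
      differentiable (fun z => ocp_phi P t z v) (xs t) &
      forall j, differentiable (ocp_g P j t) (xs t)].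
Proof.
move=> t0; have [g g0 [[_ df _] [_ dphi _] dg]] := Lip_C1 lip (@compact_set1 _ v).
split=> [||j]; [apply: df|apply: dphi|have [_ + _] := dg j] => //.
- exact: in_tube.
- exact: in_tube.
- by move=> dgj; apply: (dgj t (xs t) v) => //; exact: in_tube.
Qed.

Lemma grad_constraint_le (t : R) j : 0 <= t ->
  dot (grad (ocp_g P j t) (xs t)) (x t - xs t) <= ocp_g P j t (x t) - ocp_g P j t (xs t).
Proof.
(* The constraints do not depend on the control, so the value 0 is an arbitrary choice. *)
move=> t0; have [_ _ dg] := differentiable_data 0 t0.
have := convex_grad_le (conv t0 j) (near_xs t0) (dg j).
by rewrite [xs t + _]addrC subrK.
Qed.

Lemma ae_derive_le k : {ae leb R, forall t : R, s k < t < s k.+1 ->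
  exists2 dF : R, is_derive t 1 F dF & dF <= h t}.
Proof.
have ds := adm_dynamics adms; have dx := adm_dynamics adm.
have dp := adj_p_eq adj k.
have FF : Filter (almost_everywhere (leb R)) := ae_filter_ringOfSetsType (leb R).
have FN : Filter (nbhs (almost_everywhere (leb R))) := FF.
near=> t => /[dup] tk /andP[skt _].
have t0 : 0 <= t by rewrite (le_trans (s_ge0 k)) // ltW.
have [df dphi dg] := differentiable_data (us t) t0.
have dxst : is_derive t 1 xs (ocp_phi P t (xs t) (us t)).
  by move: t0; near: t.
have dxt : is_derive t 1 x (ocp_phi P t (x t) (u t)).
  by move: t0; near: t.
have dpt : is_derive t 1 p
   (- grad (fun y => pontryagin P t y (us t) (p t) 1) (xs t)
     + \sum_(j < l) lam j t *: grad (ocp_g P j t) (xs t)).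
  by move: tk; near: t.
have Hmax v : ocp_U P v -> pontryagin P t (xs t) v (p t) 1 <=
    pontryagin P t (xs t) (us t) (p t) 1.
  by move: v; move: t0; near: t.
have Uu : ocp_U P (u t) by have [_ _ +] := adm_u adm; apply.
have Uus : ocp_U P (us t) by have [_ _ +] := adm_u adms; apply.
have := pontryagin_le_grad (conc t0) (near_xs t0) Uu Uus Hmax
  (differentiable_pontryagin (p t) 1 df dphi).
rewrite [xs t + _]addrC subrK => Harrow.
exists (dot (- grad (fun y => pontryagin P t y (us t) (p t) 1) (xs t)
     + \sum_(j < l) lam j t *: grad (ocp_g P j t) (xs t)) (x t - xs t) +
   dot (p t) (ocp_phi P t (x t) (u t) - ocp_phi P t (xs t) (us t))).
  by apply: is_derive_dot => //; exact: is_deriveB.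
have sum_le0 : dot (\sum_(j < l) lam j t *: grad (ocp_g P j t) (xs t)) (x t - xs t) <= 0.
  rewrite dot_suml; apply: sumr_le0 => j _.
  apply: slack_dot_le0 (grad_constraint_le j t0).
  - exact: (adj_lam_ge0 adj j tk).
  - exact: slack_lam tk.
  - exact: (adm_g adm).
(* Expanding [pontryagin], the terms [dot (p t)] of the two velocities cancel against those in the
   derivative of [F], and the cost difference [h t] remains. *)
move: Harrow; rewrite /h /cost_density /pontryagin dotDl dotNl [dot (p t) (_ - _)]dotDr dotNr.
move: sum_le0.
move: (dot (\sum_(j < l) _) _) (dot (grad _ _) _) => A B A0.
lra.
Unshelve. all: by end_near. Qed.

Let L1h : L1 h.
Proof.
rewrite /L1 (_ : (fun t => (h t)%:E) =
    (EFin \o cost_density P x u) \- (EFin \o cost_density P xs us))%E //.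
by apply: integrableB; [exact: measurable_Rplus|exact: adm_J adm|exact: adm_J adms].
Qed.

Let x_ac T : abs_continuous_on `[0, T] (fun t => x t - xs t).
Proof.
by apply: abs_continuousB; [have [_ + _] := adm_x adm|have [_ + _] := adm_x adms]; apply.
Qed.

Let cvg_diff (t : R) (G : set_system R) : Filter G -> 0 <= t ->
  (\forall r \near G, 0 <= r <= t + 1) -> r @[r --> G] --> t ->
  x r - xs r @[r --> G] --> x t - xs t.
Proof.
move=> FG t0 DG Gt.
apply: (@abs_continuous_cvg _ _ `[0, t + 1]%classic (fun r => x r - xs r) t G) => //.
  by rewrite /= in_itv /= t0 lerDl ler01.
Qed.

Let integrable_oc (a b : R) : 0 <= a ->
  (leb R).-integrable (`]a, b]%classic : set R) (EFin \o h).
Proof.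
move=> a0; apply: (integrableS measurable_Rplus _ _ L1h).
  exact: measurable_itv_lebR.
by move=> t; rewrite /Rplus /= in_itv /= => /andP[/ltW/(le_trans a0)].
Qed.

(** Strictly between two jumps [p] and [x - xs] are bounded and absolutely continuous, hence so is
    their product [F]. *)
Let increment_le_inside k (c d : R) : s k < c -> c <= d -> d < s k.+1 ->
  F d - F c <= \int[leb R]_(t in (`]c, d]%classic : set R)) h t.
Proof.
move=> skc cd dsk.
have c0 : 0 <= c by rewrite (le_trans (s_ge0 k)) // ltW.
have sub : `[c, d] `<=` `]s k, s k.+1[.
  by apply: subset_itv; rewrite bnd_simp.
apply: abs_continuous_le_integral => //.
- have [M pM] := abs_continuous_bounded (adj_p_ac adj k) skc cd dsk.
  apply: (@abs_continuous_bounded_dot _ _ _ _ _ (Num.max M gamma)).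
  + by move=> t; rewrite /= in_itv /= => /pM Mt; rewrite le_max Mt.
  + move=> t; rewrite /= in_itv /= => /andP[ct _].
    by rewrite le_max near_xs ?orbT // (le_trans c0).
  + exact: abs_continuousS (adj_p_ac adj k).
  + apply: abs_continuousS (x_ac d); apply: subset_itvr; by rewrite bnd_simp.
- apply: (integrableS measurable_Rplus _ _ L1h).
    exact: measurable_itv_lebR.
  by move=> t; rewrite /Rplus /= in_itv /= => /andP[/(le_trans c0)].
- have FF : Filter (almost_everywhere (leb R)) := ae_filter_ringOfSetsType (leb R).
  apply: filterS (ae_derive_le k) => t H /andP[ct td].
  by apply: H; rewrite (lt_le_trans skc) // (le_lt_trans td).
Qed.

(** At the left end the right limit [pk] replaces [p (s k)]; at the right end left continuity of [p]
    yields the value of [F] itself. *)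
Let increment_le k (pk : 'rV[R]_n) : p t @[t --> (s k)^'+] --> pk ->
  F (s k.+1) - dot pk (x (s k) - xs (s k)) <=
  \int[leb R]_(t in (`]s k, s k.+1]%classic : set R)) h t.
Proof.
move=> ppk; have sk := adj_s_incr adj k.
have sk0 : 0 < s k.+1 by exact: le_lt_trans (s_ge0 k) sk.
apply: (@increment_le_integral_lim _ F) => //.
- exact: integrable_oc.
- apply: cvg_dot => //; apply: cvg_diff => //.
    near=> r; apply/andP; split.
      by rewrite (le_trans (s_ge0 k)) // ltW //; near: r; exact: nbhs_right_gt.
    by near: r; apply: nbhs_right_ltW; rewrite ltrDl.
  exact: cvg_at_right_filter.
- apply: cvg_dot; first exact: (adj_p_left adj).
  apply: cvg_diff; first exact: ltW.
    near=> r; apply/andP; split.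
      by rewrite ltW //; near: r; exact: nbhs_left_gt.
    rewrite ltW // (@lt_trans _ _ (s k.+1)) ?ltrDl //; near: r; exact: nbhs_left_lt.
  exact: cvg_at_left_filter.
- by move=> c d; exact: increment_le_inside.
Unshelve. all: by end_near. Qed.

Let dot_le_integral k :
  F (s k) <= \int[leb R]_(t in (`]0, s k]%classic : set R)) h t.
Proof.
elim: k => [|k IH].
  (* Both trajectories start at [ocp_x0 P], so [F] vanishes at 0. *)
  rewrite (adj_s0 adj) /F (adm_x0 adm) (adm_x0 adms) subrr dot0r.
  by rewrite set_itv_ge ?bnd_simp ?ltxx // Rintegral_set0.
have [pk ppk jump] := adj_p_jump adj k.
have jump_le : dot pk (x (s k) - xs (s k)) <= F (s k).
  rewrite -(subrK (p (s k)) pk) dotDl jump gerDr dot_suml.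
  apply: sumr_le0 => j _; apply: slack_dot_le0 (grad_constraint_le j (s_ge0 k)).
  - exact: (adj_bet_ge0 adj).
  - exact: slack_jump.
  - exact: (adm_g adm).
rewrite (Rintegral_oc_split (s_ge0 k) (ltW (adj_s_incr adj k))); last exact: integrable_oc.
rewrite -lerBlDl (le_trans _ (increment_le ppk)) // lerB //.
exact: le_trans IH.
Qed.

Let s_cvg : s k @[k --> \oo] --> +oo.
Proof.
apply/cvgryPgt => A.
have [K sK] : exists K, A < s K.
  (* Otherwise every index would belong to the finite set of [k] with [s k <= A]. *)
  apply: contrapT => nK; apply: infinite_nat.
  apply: sub_finite_set (adj_s_finite adj A) => k _ /=.
  by rewrite leNgt; apply/negP => sk; apply: nK; exists k.
have smono : {homo s : a b / (a <= b)%N >-> a <= b}.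
  by apply/nondecreasing_seqP => k; exact: ltW (adj_s_incr adj k).
by exists K => // k /= Kk; exact: lt_le_trans (smono _ _ Kk).
Qed.

Lemma Rintegral_cost_ge (pL dL : 'rV[R]_n) :
  p t @[t --> +oo] --> pL -> x t - xs t @[t --> +oo] --> dL ->
  dot pL dL <= \int[leb R]_(t in Rplus R) h t.
Proof.
move=> ppL ddL; apply: (Rintegral_Rplus_ge (v := F \o s) L1h s_cvg _ dot_le_integral).
have H : F t @[t --> +oo] --> dot pL dL by exact: cvg_dot.
exact: (cvg_comp s F s_cvg H).
Qed.

(** Ensures that the [lim] in the transversality condition is a genuine limit and not a default
    value. As the constraints ignore the control, the compact set can be the singleton of 0. *)
Lemma cvg_grad_constraint j :
  cvg (grad (ocp_g P j t) (xs t) @[t --> +oo]).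
Proof.
have [g g0 [_ _ dg]] := Lip_C1 lip (@compact_set1 _ (0 : 'rV[R]_m)).
have [_ _ dgj] := dg j.
have H i := unif_continuous_tube_cvg g0 (erefl : [set (0 : 'rV[R]_m)] 0) (Lip_xoo lip) (dgj i).
apply/cvg_ex; exists (\row_i lim ('D_(delta_mx 0 i) (ocp_g P j t) (xs t) @[t --> +oo])).
apply: cvg_row => i; rewrite mxE; under eq_cvg do rewrite mxE.
exact: H.
Qed.

(** For finite [t] each term is at most [- (b j * ocp_g P j t (xs t))], by the tangent inequality
    and feasibility of [x]; this bound tends to 0 by slackness at infinity. *)
Lemma terminal_constraint_le0 (b : 'I_l -> R) (dL : 'rV[R]_n) :
  (forall j, 0 <= b j) ->
  (forall j, b j * ocp_g P j t (xs t) @[t --> +oo] --> 0) ->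
  x t - xs t @[t --> +oo] --> dL ->
  dot (lim (\sum_(j < l) b j *: grad (ocp_g P j t) (xs t) @[t --> +oo])) dL <= 0.
Proof.
move=> b0 slack ddL.
have cL : cvg (\sum_(j < l) b j *: grad (ocp_g P j t) (xs t) @[t --> +oo]).
  apply/cvg_ex; exists (\sum_(j < l) b j *: lim (grad (ocp_g P j t) (xs t) @[t --> +oo])).
  apply: cvg_big => [|j _]; first exact: add_continuous.
  by apply: cvgZl_tmp; exact: cvg_grad_constraint.
have slack_sum : (\sum_(j < l) - (b j * ocp_g P j t (xs t))) @[t --> +oo] --> (0 : R).
  have sum0 : \sum_(j < l) - (0 : R) = 0 by rewrite big1 // => ? _; rewrite oppr0.
  rewrite -[X in _ --> X]sum0; apply: cvg_big => [|j _]; first exact: add_continuous.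
  exact: cvgN.
apply: (ler_cvg_to (cvg_dot _ cL ddL) slack_sum).
near=> t; have t0 : 0 <= t by near: t; exact: nbhs_pinfty_ge.
rewrite dot_suml; apply: ler_sum => j _.
rewrite dotZl (le_trans (ler_wpM2l (b0 j) (grad_constraint_le j t0))) //.
rewrite mulrBr gerDr; apply: mulr_ge0_le0 => //; exact: (adm_g adm).
Unshelve. all: by end_near. Qed.

Lemma J_le_of_Rintegral_ge0 :
  0 <= \int[leb R]_(t in Rplus R) h t -> (J P xs us <= J P x u)%E.
Proof.
rewrite /h RintegralB; [|exact: measurable_Rplus|exact: adm_J adm|exact: adm_J adms].
rewrite subr_ge0 -lee_fin /Rintegral !fineK //.
- exact: (integrable_fin_num measurable_Rplus (adm_J adm)).
- exact: (integrable_fin_num measurable_Rplus (adm_J adms)).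
Qed.

End verification.

Theorem theorem5p5 (R : realType) (n m l : nat) (P : ocp R n m l)
  (xs : R -> 'rV[R]_n) (us : R -> 'rV[R]_m)
  (p : R -> 'rV[R]_n) (l0 l1 : 'rV[R]_n) (bet_oo : 'I_l -> R)
  (s : nat -> R) (bet : 'I_l -> nat -> R) (lam : 'I_l -> R -> R) :
  ocp_wf P ->
  admissible P xs us ->
  A_Lip P xs us ->
  (forall j, 0 <= bet_oo j) ->
  piecewise_adjoint P xs us p s bet lam ->
  p 0 = l0 ->
  p t @[t --> +oo] -->
    - l1 - lim (\sum_(j < l) bet_oo j *: grad (ocp_g P j t) (xs t)
                @[t --> +oo]) ->
  (forall x u, admissible P x u ->
     dot l0 (x 0 - xs 0) = 0 /\
     dot l1 (lim (x t - xs t @[t --> +oo])) = 0) ->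
  {ae leb R, forall t : R, 0 <= t ->
     forall v, ocp_U P v ->
       pontryagin P t (xs t) v (p t) 1 <= pontryagin P t (xs t) (us t) (p t) 1} ->
  (forall j k, bet j k * ocp_g P j (s k) (xs (s k)) = 0) ->
  (forall j, bet_oo j * ocp_g P j t (xs t) @[t --> +oo] --> 0) ->
  (forall j k t, s k < t < s k.+1 -> lam j t * ocp_g P j t (xs t) = 0) ->
  (exists2 gamma : R, 0 < gamma & forall t, 0 <= t ->
     concave_on [set y | `|y - xs t| <= gamma]
       (fun y => hamiltonian P t y (p t)) /\
     forall j, convex_function
       ([set y | `|y - xs t| <= gamma] : set (convex_lmodType 'rV[R]_n))
       (ocp_g P j t)) ->
  strong_local_minimizer P xs us.
Proof.
move=> _ adms lip bet_oo0 adj _ pL endl maxH slack_jump slack_oo slack_lam [gamma g0 cc].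
(* The radius of optimality is the radius on which concavity and convexity hold. *)
split=> //; exists gamma => // x u adm near_xs.
have conc t : 0 <= t -> concave_on [set y | `|y - xs t| <= gamma]
    (fun y => hamiltonian P t y (p t)) by case/cc.
have conv t : 0 <= t -> forall j, convex_function
    ([set y | `|y - xs t| <= gamma] : set (convex_lmodType 'rV[R]_n)) (ocp_g P j t).
  by case/cc.
have ddL : x t - xs t @[t --> +oo] --> lim (x t - xs t @[t --> +oo]).
  have [cx _] := adm_x1 adm; have [cxs _] := adm_x1 adms.
  exact: (is_cvgB cx cxs).
apply: (J_le_of_Rintegral_ge0 adms adm).
apply: le_trans (Rintegral_cost_ge adms lip adj maxH slack_jump slack_lam
  conc conv adm near_xs pL ddL).
have [_ l1_orth] := endl x u adm.
(* The [l1] part of the terminal value of [p] is orthogonal to the endpoint variation, which leaves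
   minus the terminal constraint term. *)
rewrite dotDl !dotNl l1_orth oppr0 add0r oppr_ge0.
exact: (terminal_constraint_le0 lip conv adm near_xs bet_oo0 slack_oo ddL).
Qed.
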